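(* Let $\mathcal P=\{p_\theta:\theta\in\Theta\subseteq\mathbb R^d\}$ be a parametrized family of distributions, $n,s\ge1$ integers, and $P,\sigma_0^2,\epsilon>0$. Consider estimation of $\theta$ from $n$ users over the Gaussian multiple-access channel with power constraint $P$, channel noise variance $\sigma_0^2$ and $s$ channel uses. Then the $\epsilon$-robust over-the-air estimation scheme satisfies, for every $\theta\in\Theta$, $$I_\theta(Y;U_i\mid U_1,\dots,U_{i-1},U_{i+1},\dots,U_n)\le\epsilon,\qquad\forall\,1\le i\le n,$$ and its minimax (worst-case over $\theta\in\Theta$) estimation error is $R^*(\mathcal P,\,P-\sigma_{pri}^2,\,\sigma_0^2+n\sigma_{pri}^2,\,s)$, where $\sigma_{pri}^2=\max\{\frac{sP-2\epsilon\sigma_0^2}{2\epsilon n+s},0\}$.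
   Context: Setting: $U_1,\dots,U_n$ are i.i.d. with law $p_\theta\in\mathcal P$. User $i$ sends $X_i=(X_{i1},\dots,X_{is})=f(U_i)$, where $f$ is a (possibly randomized, independently across users) encoding function common to all users. The processor receives $Y=(Y_1,\dots,Y_s)$ with $Y_j=\sum_{i=1}^nX_{ij}+Z_j$, where the $Z_j\sim\mathcal N(0,\sigma_0^2)$ are i.i.d. and independent of everything else. Power constraint $P$: $\frac1s\sum_{j=1}^s\mathbb E_{\theta,f}[X_{ij}^2]\le P$ for all $i$ (and all $\theta\in\Theta$). The estimation error of a pair $(\hat\theta,f)$ is $R_\theta(\hat\theta,f)=\mathbb E_{\theta,f}\|\hat\theta(Y)-\theta\|_2^2$, and its minimax (worst-case) error is $R(\hat\theta,f)=\sup_{\theta\in\Theta}R_\theta(\hat\theta,f)$. For given $(\mathcal P,P,\sigma_0^2,s)$, the pair $(\hat\theta^*(\mathcal P,P,\sigma_0^2,s),f^*(\mathcal P,P,\sigma_0^2,s))$ denotes a minimax optimal scheme (taken to exist), i.e. a pair minimizing $R(\hat\theta,f)$ among the considered schemes whose encoding function is deterministic, invertible and satisfies power constraint $P$, when the channel noise variance is $\sigma_0^2$ and there are $s$ channel uses; $R^*(\mathcal P,P,\sigma_0^2,s)$ denotes its worst-case error. $\epsilon$-robust over-the-air estimation scheme (for power constraint $P$, noise variance $\sigma_0^2$, $s$ channel uses): with $\sigma_{pri}^2=\max\{\frac{sP-2\epsilon\sigma_0^2}{2\epsilon n+s},0\}$, user $i$ sends $X_i=f^*(\mathcal P,P-\sigma_{pri}^2,\sigma_0^2+n\sigma_{pri}^2,s)(U_i)+Z_{pri,i}$,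 where $Z_{pri,1},\dots,Z_{pri,n}\sim\mathcal N(0,\sigma_{pri}^2I_s)$ are i.i.d. and independent of the data and channel noise; the processor uses the estimator $\hat\theta^*(\mathcal P,P-\sigma_{pri}^2,\sigma_0^2+n\sigma_{pri}^2,s)$. $I_\theta(\cdot;\cdot\mid\cdot)$ is conditional mutual information (natural logarithm) under $p_\theta$. *)

(* Defs.v *)
From HB Require Import structures.
From mathcomp Require Import all_boot all_order all_algebra.
From mathcomp Require Import all_classical all_reals all_analysis.
From mathcomp Require Import measurable_realfun.

Set Implicit Arguments.
Unset Strict Implicit.
Unset Printing Implicit Defensive.
Import Order.TTheory GRing.Theory Num.Theory.
Import numFieldNormedType.Exports.

Local Open Scope classical_set_scope.
Local Open Scope ring_scope.
Local Open Scope ereal_scope.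
Local Open Scope charge_scope.

Section product_laws.
Context {dT : measure_display} {T : measurableType dT} {R : realType}.

Definition tcons n (x : T * n.-tuple T) : n.+1.-tuple T := [tuple of x.1 :: x.2].

Lemma measurable_tcons n : measurable_fun [set: T * n.-tuple T] (@tcons n).
Proof. exact: measurable_cons. Qed.

HB.instance Definition _ n :=
  isMeasurableFun.Build _ _ _ _ (@tcons n) (@measurable_tcons n).

Fixpoint iid n (m : probability T R) : probability (n.-tuple T) R :=
  if n is n'.+1 then
    (distribution (m \x iid n' m : probability _ R) (@tcons n')
      : probability (n'.+1.-tuple T) R)
  else (\d_([tuple] : 0.-tuple T) : probability (0.-tuple T) R).

End product_laws.

Section gaussian.
Context {R : realType}.

(* normal_prob lives on measurableTypeR R, which has the Borel sets of R under
   another display; this identity map carries it over to R. *)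
Definition ofTR (x : measurableTypeR R) : R := x.

Lemma measurable_ofTR : measurable_fun [set: measurableTypeR R] ofTR.
Proof. by move=> _ A mA; rewrite setTI. Qed.

HB.instance Definition _ :=
  isMeasurableFun.Build _ _ _ _ ofTR measurable_ofTR.

(* Parametrized by the variance. The case v = 0 has to be treated apart since
   the library sets normal_prob m 0 to be the uniform law on [0, 1]. *)
Definition gaussian0 (v : R) : probability R R :=
  if v == 0%R then (\d_(0%R : R) : probability R R)
  else (distribution
    (normal_prob (0%R : R) (Num.sqrt v) : probability (measurableTypeR R) R)
    ofTR : probability R R).

Definition gaussian_vec s (v : R) : probability (s.-tuple R) R :=
  iid s (gaussian0 v).

End gaussian.

Section information.
Context {R : realType}.

(* Kullback-Leibler divergence D(mu || nu), in nats. *)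
Definition KL {dT} {T : measurableType dT} (mu nu : probability T R) : \bar R :=
  if `[< mu `<< nu >]
  then \int[mu]_x (ln (fine (('d (charge_of_finite_measure mu) '/d nu) x)))%:E
  else +oo.

Context {dO d1 d2 d3} {Omega : measurableType dO} {T1 : measurableType d1}
  {T2 : measurableType d2} {T3 : measurableType d3}.
Implicit Types (P : probability Omega R).

Definition joint3 (X : {mfun Omega >-> T1}) (Y : {mfun Omega >-> T2})
  (Z : {mfun Omega >-> T3}) (w : Omega) : T1 * (T2 * T3) := (X w, (Y w, Z w)).

Lemma measurable_joint3 X Y Z : measurable_fun [set: Omega] (joint3 X Y Z).
Proof.
apply: measurable_fun_pair => //; exact: measurable_fun_pair.
Qed.

HB.instance Definition _ X Y Z :=
  isMeasurableFun.Build _ _ _ _ (joint3 X Y Z) (measurable_joint3 X Y Z).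

End information.

Section conditional_information.
Context {R : realType}.

Definition is_cond_law {dO d1 d3} {Omega : measurableType dO}
    {T1 : measurableType d1} {T3 : measurableType d3}
    (P : probability Omega R) (X : {mfun Omega >-> T1})
    (Z : {mfun Omega >-> T3}) (k : R.-pker T3 ~> T1) :=
  forall A C, measurable A -> measurable C ->
    P (X @^-1` A `&` Z @^-1` C) = \int[distribution P Z]_(z in C) k z A.

Context {dO d1 d2 d3} {Omega : measurableType dO} {T1 : measurableType d1}
  {T2 : measurableType d2} {T3 : measurableType d3}.

(* nu is the measure P_{X|Z} P_{Y|Z} P_Z. Two such nu agree on measurable
   boxes, which generate the sigma-algebra and are stable by intersection, so
   there is at most one. *)
Definition is_cond_product (P : probability Omega R)
    (X : {mfun Omega >-> T1}) (Y : {mfun Omega >-> T2})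
    (Z : {mfun Omega >-> T3}) (nu : probability (T1 * (T2 * T3))%type R) :=
  exists (kX : R.-pker T3 ~> T1) (kY : R.-pker T3 ~> T2),
    [/\ is_cond_law P X Z kX, is_cond_law P Y Z kY &
      forall A B C, measurable A -> measurable B -> measurable C ->
        nu (A `*` (B `*` C)) =
        \int[distribution P Z]_(z in C) (kX z A * kY z B)].

(* I(X; Y | Z) = D(P_{XYZ} || P_{X|Z} P_{Y|Z} P_Z). The infimum ranges over a
   set with at most one element; it is +oo if there are no regular conditional
   laws. *)
Definition cond_mutual_info (P : probability Omega R)
    (X : {mfun Omega >-> T1}) (Y : {mfun Omega >-> T2})
    (Z : {mfun Omega >-> T3}) : \bar R :=
  ereal_inf [set KL (distribution P (joint3 X Y Z)) nu
            | nu in is_cond_product P X Y Z].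

End conditional_information.

(* A randomized encoder is a measurable function f of the user's data (in U) and
   of a private seed (in W) of law rho. A sample consists of the n pairs
   (data, seed) and the channel noise. *)
Section channel.
Context {R : realType} {dU dW} {U : measurableType dU} {W : measurableType dW}.
Variables (n s : nat).

Local Notation sample := (n.-tuple (U * W) * s.-tuple R)%type.

Definition sample_law (m : probability U R) (rho : probability W R) (v : R)
    : probability sample R :=
  (iid n (m \x rho : probability _ R) \x gaussian_vec s v
    : probability sample R).

Definition data (i : 'I_n) (w : sample) : U := (tnth w.1 i).1.

Definition data_except (i : 'I_n) (w : sample) : n.-1.-tuple U :=
  [tuple data (lift i j) w | j < n.-1].

Definition received (f : {mfun (U * W)%type >-> s.-tuple R}) (w : sample)
    : s.-tuple R :=
  [tuple (\sum_(i < n) tnth (f (tnth w.1 i)) j + tnth w.2 j)%R | j < s].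

Lemma measurable_data i : measurable_fun [set: sample] (data i).
Proof.
apply: (measurableT_comp measurable_fst).
by apply: (measurableT_comp (measurable_tnth i)).
Qed.

Lemma measurable_data_except i : measurable_fun [set: sample] (data_except i).
Proof.
apply/measurable_fun_tnthP => j.
rewrite [X in measurable_fun _ X](_ : _ = data (lift i j)).
  exact: measurable_data.
by apply/funext => w /=; rewrite tnth_mktuple.
Qed.

Lemma measurable_received f : measurable_fun [set: sample] (received f).
Proof.
apply/measurable_fun_tnthP => j.
rewrite [X in measurable_fun _ X](_ : _ = fun w : sample =>
    (\sum_(i < n) tnth (f (tnth w.1 i)) j + tnth w.2 j)%R); last first.
  by apply/funext => w /=; rewrite tnth_mktuple.
apply: measurable_funD.
  apply: measurable_sum => i.
  apply: (measurableT_comp (measurable_tnth j)).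
  apply: (measurableT_comp (measurable_funP f)).
  by apply: (measurableT_comp (measurable_tnth i)).
by apply: (measurableT_comp (measurable_tnth j)).
Qed.

HB.instance Definition _ i :=
  isMeasurableFun.Build _ _ _ _ (data i) (measurable_data i).
HB.instance Definition _ i :=
  isMeasurableFun.Build _ _ _ _ (data_except i) (measurable_data_except i).
HB.instance Definition _ f :=
  isMeasurableFun.Build _ _ _ _ (received f) (measurable_received f).

End channel.

Definition sqdist {R : realType} {d} (x y : d.-tuple R) : R :=
  (\sum_(k < d) (tnth x k - tnth y k) ^+ 2)%R.

Section risk.
Context {R : realType} {dU} {U : measurableType dU}.
Variables (d n s : nat) (Theta : set (d.-tuple R))
  (p : d.-tuple R -> probability U R).

Section randomized.
Context {dW} {W : measurableType dW}.
Variables (rho : probability W R) (f : {mfun (U * W)%type >-> s.-tuple R}).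

Definition risk (v : R) (est : {mfun s.-tuple R >-> d.-tuple R})
    (theta : d.-tuple R) : \bar R :=
  \int[sample_law n s (p theta) rho v]_w
    (sqdist (est (received f w)) theta)%:E.

Definition worst_risk (v : R) (est : {mfun s.-tuple R >-> d.-tuple R})
    : \bar R :=
  ereal_sup [set risk v est theta | theta in Theta].

Definition power_constraint (P : R) :=
  forall theta, Theta theta ->
    (s%:R^-1)%:E *
      (\sum_(j < s) \int[p theta \x rho]_x ((tnth (f x) j) ^+ 2)%:E) <= P%:E.

End randomized.

(* A deterministic encoder ignores its seed, which is taken in unit. *)
Definition det_encoder (g : U -> s.-tuple R) (x : U * unit) : s.-tuple R :=
  g x.1.

Lemma measurable_det_encoder (g : {mfun U >-> s.-tuple R}) :
  measurable_fun [set: (U * unit)%type] (det_encoder g).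
Proof. exact: (measurableT_comp (measurable_funP g)). Qed.

HB.instance Definition _ (g : {mfun U >-> s.-tuple R}) :=
  isMeasurableFun.Build _ _ _ _ (det_encoder g) (measurable_det_encoder g).

Definition no_seed : probability unit R := \d_tt.

Definition det_worst_risk (v : R) (g : {mfun U >-> s.-tuple R})
    (est : {mfun s.-tuple R >-> d.-tuple R}) : \bar R :=
  worst_risk no_seed (det_encoder g) v est.

Definition admissible (P : R) (g : {mfun U >-> s.-tuple R}) :=
  injective g /\ power_constraint no_seed (det_encoder g) P.

Definition minimax_optimal (P v : R) (est : {mfun s.-tuple R >-> d.-tuple R})
    (g : {mfun U >-> s.-tuple R}) :=
  admissible P g /\
  forall est' g', admissible P g' ->
    det_worst_risk v g est <= det_worst_risk v g' est'.

End risk.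

Section robust_scheme.
Context {R : realType}.

Definition sigma_pri2 (n s : nat) (P v eps : R) : R :=
  Num.max ((s%:R * P - 2 * eps * v) / (2 * eps * n%:R + s%:R))%R 0%R.

Context {dU} {U : measurableType dU} {s : nat}.

Definition robust_encoder (g : U -> s.-tuple R) (x : U * s.-tuple R)
    : s.-tuple R :=
  [tuple (tnth (g x.1) j + tnth x.2 j)%R | j < s].

Lemma measurable_robust_encoder (g : {mfun U >-> s.-tuple R}) :
  measurable_fun [set: (U * s.-tuple R)%type] (robust_encoder g).
Proof.
apply/measurable_fun_tnthP => j.
rewrite [X in measurable_fun _ X](_ : _ = fun x : U * s.-tuple R =>
    (tnth (g x.1) j + tnth x.2 j)%R); last first.
  by apply/funext => w /=; rewrite tnth_mktuple.
apply: measurable_funD.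
  apply: (measurableT_comp (measurable_tnth j)).
  by apply: (measurableT_comp (measurable_funP g)).
by apply: (measurableT_comp (measurable_tnth j)).
Qed.

HB.instance Definition _ (g : {mfun U >-> s.-tuple R}) :=
  isMeasurableFun.Build _ _ _ _ (robust_encoder g) (measurable_robust_encoder g).

End robust_scheme.

(* Main.v *)
(* Conditionally on the other users' data, Y = c + f(U_i) + N, where c is known
   and N ~ N(0, v I) with v = v0 + n vpri: the n privacy noises and the channel
   noise add up to one Gaussian vector. This gives the risk at once.
   With gam = N(0, v I), Cameron-Martin gives the law of f(u) + N the density
   e(u, z) with respect to gam, so the law of Y - c has density
   q(z) = E e(U_i, z) and the information is E ln (e / q). Comparing with
   q = 1 through - ln q <= 1/q - 1, whose right-hand side has expectation 0,
   leaves E ln e = E |f(U_i)|^2 / (2 v) <= s (P - vpri) / (2 v) <= eps, the last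
   step being the choice of vpri. *)
From HB Require Import structures.
Require Import Defs.
From mathcomp Require Import all_boot all_order all_algebra.
From mathcomp Require Import all_classical all_reals all_analysis.
From mathcomp Require Import measurable_realfun ring lra.
Import Order.TTheory GRing.Theory Num.Theory.
Import numFieldNormedType.Exports.
Local Open Scope classical_set_scope.
Local Open Scope ring_scope.

(** * Gaussian integrals on the line *)

(** [cond_mutual_info] is an infimum over conditional product laws, so exhibiting one such law
    bounds it. The users being independent, that law can be built outright: the output is
    regenerated from a fresh copy of [U_i], which gives explicit kernels instead of a
    disintegration. Distributions are handled as identities between integrals of nonnegative
    functions, so that Tonelli applies without integrability conditions. Signed integrals come in
    only with the logarithm: it is dominated by an explicit integrable function, in which the inner
    product of signal and noise has mean 0 because Gaussian coordinates are integrable and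
    symmetric. The privacy variance may be 0, where [gaussian0] is a Dirac mass without density; the
    convolution lemmas therefore allow variance 0 in one summand, and the channel noise keeps the
    total variance positive. Comparing with [q = 1] corresponds to replacing [ln (1 + x)] by [x] in
    the Gaussian capacity; [sigma_pri2] is calibrated to this linear bound. *)

Lemma ge0_integral_density {d} {T : measurableType d} {R : realType}
    (nu : {finite_measure set T -> \bar R})
    (mu : {sigma_finite_measure set T -> \bar R}) (k : T -> R) (f : T -> \bar R) :
  measurable_fun setT k -> (forall x, 0 <= k x) ->
  (forall A, measurable A -> nu A = (\int[mu]_(x in A) (k x)%:E)%E) ->
  measurable_fun setT f -> (forall x, 0 <= f x)%E ->
  (\int[nu]_x f x = \int[mu]_x (f x * (k x)%:E))%E.
Proof.
move=> mk k0 nuE mf f0.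
have mEk : measurable_fun setT (EFin \o k) by exact/measurable_EFinP.
have numu : nu `<< mu.
  apply/null_content_dominatesP => A mA muA0; rewrite nuE//.
  by apply: null_set_integral => //; exact: measurable_funTS.
(* The change of variables involves the Radon-Nikodym derivative; [k] equals it almost everywhere,
   since both integrate to [nu] over every measurable set. *)
rewrite -(Radon_Nikodym_SigmaFinite.change_of_variables numu)//.
have ig := Radon_Nikodym_SigmaFinite.f_integrable numu.
apply: ae_eq_integral => //.
- by apply: emeasurable_funM => //; exact: measurable_int ig.
- by apply: emeasurable_funM.
- apply: ae_eqe_mul2l; apply: integral_ae_eq => // A _ mA.
  by rewrite -Radon_Nikodym_SigmaFinite.f_integral// nuE.
Qed.

Section gaussian_line.
Context {R : realType}.
Local Notation leb := (@lebesgue_measure R).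
Implicit Types (f : R -> \bar R) (a b v x y : R).

(** Translation preserves the length of half-open intervals, and a measure with these values on
    intervals is Lebesgue measure. *)
Lemma ge0_integral_lebesgue_shift f a :
  measurable_fun setT f -> (forall x, 0 <= f x)%E ->
  (\int[leb]_x f (x + a)%R = \int[leb]_x f x)%E.
Proof.
move=> mf f0.
pose phi (x : measurableTypeR R) : measurableTypeR R := x + a.
have mphi : measurable_fun setT phi.
  by apply: (@measurable_funD _ _ R setT id (cst a)).
transitivity (\int[pushforward leb phi]_x f x)%E.
  by rewrite ge0_integral_pushforward// preimage_setT.
pose phi' : {mfun measurableTypeR R >-> measurableTypeR R} :=
  HB.pack phi (isMeasurableFun.Build _ _ _ _ phi mphi).
apply: eq_measure_integral => A mA _.
apply/esym; apply: (@lebesgue_measure_unique R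
  (pushforward leb phi' : {measure set _ -> \bar R})) => // _ [[x y] _ <-].
transitivity (leb `]x - a, y - a]%classic).
  by rewrite !lebesgue_measure_itv/= !lte_fin ltrD2r -!EFinD/=; case: ifP => //;
    rewrite opprB addrA subrK.
rewrite /pushforward/=; congr (leb _).
by apply/seteqP; split=> z /=; rewrite !in_itv/= /phi/= ltrBlDr lerBrDr.
Qed.

Definition gaussian_density v x : R := normal_pdf 0 (Num.sqrt v) x.

Lemma gaussian_densityE v x : 0 < v ->
  gaussian_density v x = (Num.sqrt (v * pi *+ 2))^-1 * expR (- x ^+ 2 / (v *+ 2)).
Proof.
move=> v0; rewrite /gaussian_density normal_pdfE ?gt_eqF ?sqrtr_gt0//.
by rewrite /normal_peak /normal_fun sqr_sqrtr ?ltW// subr0.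
Qed.

Lemma gaussian_density_ge0 v x : 0 <= gaussian_density v x.
Proof. exact: normal_pdf_ge0. Qed.

Lemma measurable_gaussian_density v : measurable_fun setT (gaussian_density v).
Proof. exact: measurable_normal_pdf. Qed.

Lemma integral_gaussian_density v : (\int[leb]_x (gaussian_density v x)%:E = 1)%E.
Proof. exact: integral_normal_pdf. Qed.

Lemma ge0_integral_gaussian0 v f : 0 < v ->
  measurable_fun setT f -> (forall x, 0 <= f x)%E ->
  (\int[gaussian0 v]_x f x = \int[leb]_x (f x * (gaussian_density v x)%:E))%E.
Proof.
move=> v0 mf f0; rewrite /gaussian0 gt_eqF//.
rewrite ge0_integral_distribution//.
apply: ge0_integral_density => //=.
- exact: measurable_gaussian_density.
- exact: gaussian_density_ge0.
Qed.

(** One-dimensional Cameron-Martin formula: the exponential is the ratio of the densities of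
    [N(a, v)] and [N(0, v)]. Translating the right-hand integral by [a] makes the integrands
    equal. *)
Lemma ge0_integral_gaussian0_shift v a f : 0 < v ->
  measurable_fun setT f -> (forall x, 0 <= f x)%E ->
  (\int[gaussian0 v]_x f (a + x)%R =
   \int[gaussian0 v]_x (f x * (expR ((a * x - a ^+ 2 / 2) / v))%:E))%E.
Proof.
move=> v0 mf f0.
rewrite ge0_integral_gaussian0//; last first.
  by apply: measurableT_comp => //; exact: measurable_funD.
rewrite ge0_integral_gaussian0//; first last.
- by move=> x; rewrite mule_ge0// lee_fin expR_ge0.
- apply: emeasurable_funM => //; apply/measurable_EFinP.
  apply: measurableT_comp => //; apply: measurable_funM => //.
  by apply: measurable_funB => //; exact: measurable_funM.
rewrite -[RHS](ge0_integral_lebesgue_shift _ a)/=; first last.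
- by move=> x; rewrite !mule_ge0// lee_fin ?expR_ge0 ?gaussian_density_ge0.
- apply: emeasurable_funM => //; last first.
    by apply/measurable_EFinP; exact: measurable_gaussian_density.
  apply: emeasurable_funM => //; apply/measurable_EFinP.
  apply: measurableT_comp => //; apply: measurable_funM => //.
  by apply: measurable_funB => //; exact: measurable_funM.
apply: eq_integral => x _; rewrite -muleA (addrC a); congr (_ * _)%E.
rewrite !gaussian_densityE// -EFinM mulrCA -expRD; congr (_ * expR _)%:E.
by field; rewrite gt_eqF.
Qed.

(** Completing the square in [x]: the joint density of a summand and the sum is the density of the
    sum at [y] times the conditional density of the summand, normal with mean [a / (a + b) * y] and
    variance [a * b / (a + b)]. *)
Lemma gaussian_density_conv a b x y : 0 < a -> 0 < b ->
  gaussian_density a x * gaussian_density b (y - x) =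
  gaussian_density (a + b) y * gaussian_density (a * b / (a + b)) (x + - (a / (a + b) * y)).
Proof.
move=> a0 b0; have ab0 : 0 < a + b by exact: addr_gt0.
have c0 : 0 < a * b / (a + b) by rewrite divr_gt0// mulr_gt0.
rewrite !gaussian_densityE// mulrACA -expRD [RHS]mulrACA -expRD -!invfM.
rewrite -!sqrtrM ?mulrn_wge0 ?mulr_ge0 ?pi_ge0 ?(ltW a0) ?(ltW b0) ?(ltW ab0)//.
congr (_^-1 * expR _).
  by congr Num.sqrt; field; rewrite gt_eqF.
by field; rewrite !gt_eqF.
Qed.

Lemma measurable_gaussian_densityB b x :
  measurable_fun setT (fun y => (gaussian_density b (y - x))%:E).
Proof.
apply/measurable_EFinP; apply: measurableT_comp; first exact: measurable_gaussian_density.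
exact: measurable_funB.
Qed.

Lemma ge0_integral_gaussian0_translate b x f : 0 < b ->
  measurable_fun setT f -> (forall x, 0 <= f x)%E ->
  (\int[gaussian0 b]_y f (x + y)%R =
   \int[leb]_y (f y * (gaussian_density b (y - x))%:E))%E.
Proof.
move=> b0 mf f0.
rewrite ge0_integral_gaussian0; [|exact: b0| |by []]; last first.
  by apply: measurableT_comp => //; exact: measurable_funD.
rewrite -[RHS](ge0_integral_lebesgue_shift _ x)/=; first last.
- by move=> y; rewrite mule_ge0// lee_fin gaussian_density_ge0.
- by apply: emeasurable_funM => //; exact: measurable_gaussian_densityB.
by apply: eq_integral => y _; rewrite addrK addrC.
Qed.

(** For [a = 0] the outer law is the Dirac mass at 0. For [a > 0], translation makes [y] the value
    of the sum, Tonelli brings [x] inside, and the conditional density of [x] given the sum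
    integrates to 1. *)
Lemma ge0_integral_gaussian0_conv a b f : 0 <= a -> 0 < b ->
  measurable_fun setT f -> (forall x, 0 <= f x)%E ->
  (\int[gaussian0 a]_x \int[gaussian0 b]_y f (x + y)%R =
   \int[gaussian0 (a + b)]_z f z)%E.
Proof.
move=> + b0 mf f0; rewrite le_eqVlt => /orP[/eqP<-|a0].
  have -> : gaussian0 (0 : R) = \d_(0 : R) by rewrite /gaussian0 eqxx.
  rewrite add0r integral_dirac//=.
    by rewrite diracT mul1e; apply: eq_integral => y _; rewrite add0r.
  apply: (measurable_fun_fubini_tonelli_F (fun z : R * R => f (z.1 + z.2))) => //.
  by apply: measurableT_comp => //; exact: measurable_funD.
have ab0 : 0 < a + b by exact: addr_gt0.
transitivity (\int[leb]_x \int[leb]_y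
    (f y * (gaussian_density b (y - x))%:E * (gaussian_density a x)%:E))%E.
  rewrite ge0_integral_gaussian0//; first last.
  - by move=> x; exact: integral_ge0.
  - apply: (measurable_fun_fubini_tonelli_F (fun z : R * R => f (z.1 + z.2))) => //.
    by apply: measurableT_comp => //; exact: measurable_funD.
  apply: eq_integral => x _.
  rewrite ge0_integralZr//; first last.
  - by rewrite lee_fin gaussian_density_ge0.
  - by move=> y _; rewrite mule_ge0// lee_fin gaussian_density_ge0.
  - by apply: emeasurable_funM => //; exact: measurable_gaussian_densityB.
  by congr (_ * _)%E; exact: ge0_integral_gaussian0_translate.
rewrite (fubini_tonelli (fun z : measurableTypeR R * measurableTypeR R =>
   (f z.2 * (gaussian_density b (z.2 - z.1))%:E *
    (gaussian_density a z.1)%:E))%E)//=; first last.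
- by move=> z; rewrite !mule_ge0// lee_fin gaussian_density_ge0.
- apply: emeasurable_funM; last first.
    apply/measurable_EFinP; apply: (measurableT_comp (measurable_gaussian_density a)).
    exact: measurable_fst.
  apply: emeasurable_funM; first exact: (measurableT_comp mf measurable_snd).
  apply/measurable_EFinP; apply: (measurableT_comp (measurable_gaussian_density b)).
  by apply: (@measurable_funB _ _ R setT snd fst).
rewrite ge0_integral_gaussian0//; apply: eq_integral => y _.
under eq_integral.
  move=> x _; rewrite -muleA -EFinM (mulrC (gaussian_density b _)).
  rewrite gaussian_density_conv// EFinM muleA.
  over.
rewrite ge0_integralZl//; first last.
- by rewrite mule_ge0// lee_fin gaussian_density_ge0.
- by move=> x _; rewrite lee_fin gaussian_density_ge0.
- exact: measurable_gaussian_densityB.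
rewrite (ge0_integral_lebesgue_shift (fun x => (gaussian_density (a * b / (a + b)) x)%:E))//.
- by rewrite integral_gaussian_density mule1.
- by apply/measurable_EFinP; exact: measurable_gaussian_density.
- by move=> x; rewrite lee_fin gaussian_density_ge0.
Qed.

End gaussian_line.

(** * Integrals over i.i.d. tuples *)

Lemma measurable_fun_tcons {d1 d2} {T1 : measurableType d1} {T2 : measurableType d2}
    {n} (f : T1 -> T2) (g : T1 -> n.-tuple T2) :
  measurable_fun setT f -> measurable_fun setT g ->
  measurable_fun setT (fun x => tcons (f x, g x)).
Proof. exact: measurable_cons. Qed.

Ltac measurable_proj := repeat first
  [ exact: measurable_id | exact: measurable_cst | exact: measurable_fst
  | exact: measurable_snd
  | apply: measurable_fun_tcons | apply: measurable_fun_pair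
  | apply: (measurableT_comp measurable_fst)
  | apply: (measurableT_comp measurable_snd) ].

Section iid_integrals.
Context {R : realType}.
Local Open Scope ereal_scope.

Lemma ge0_integral_iid0 {d} {T : measurableType d} (m : probability T R)
    (F : 0.-tuple T -> \bar R) :
  measurable_fun setT F -> \int[iid 0 m]_t F t = F [tuple].
Proof. by move=> mF; rewrite integral_dirac// diracT mul1e. Qed.

Lemma ge0_integral_iidS {d} {T : measurableType d} (m : probability T R) n
    (F : n.+1.-tuple T -> \bar R) :
  measurable_fun setT F -> (forall t, 0 <= F t) ->
  \int[iid n.+1 m]_t F t = \int[m]_x \int[iid n m]_t F (tcons (x, t)).
Proof.
move=> mF F0; rewrite /= ge0_integral_distribution//.
rewrite fubini_tonelli1//; first exact: (measurableT_comp mF (@measurable_tcons _ _ _)).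
by move=> z; exact: F0.
Qed.

(** Written with [unlift], the partial inverse of the [lift] through which [data_except] reads the
    other users, so that deleting coordinate [i] gives [t] back. *)
Definition tinsert {T} {n} (i : 'I_n.+1) (x : T) (t : n.-tuple T) : n.+1.-tuple T :=
  [tuple (if unlift i k is Some j then tnth t j else x) | k < n.+1].

Lemma tnth_tinsert {T} {n} (i : 'I_n.+1) (x : T) (t : n.-tuple T) :
  tnth (tinsert i x t) i = x.
Proof. by rewrite tnth_mktuple unlift_none. Qed.

Lemma tnth_tinsert_lift {T} {n} (i : 'I_n.+1) (x : T) (t : n.-tuple T) j :
  tnth (tinsert i x t) (lift i j) = tnth t j.
Proof. by rewrite tnth_mktuple liftK. Qed.

Lemma tinsert0 {d} {T : measurableType d} {n} (x : T) (t : n.-tuple T) :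
  tinsert ord0 x t = tcons (x, t).
Proof.
apply: eq_from_tnth => k; case: (unliftP ord0 k) => [j|] ->.
  by rewrite tnth_tinsert_lift tnthS.
by rewrite tnth_tinsert tnth0.
Qed.

Lemma tinsert_tcons {d} {T : measurableType d} {n} (i : 'I_n.+1) (x y : T) (t : n.-tuple T) :
  tinsert (lift ord0 i) x (tcons (y, t)) = tcons (y, tinsert i x t).
Proof.
apply: eq_from_tnth => k; case: (unliftP ord0 k) => [k'|] ->.
  rewrite tnthS/=; case: (unliftP i k') => [j|] ->.
    rewrite tnth_tinsert_lift.
    have -> : lift ord0 (lift i j) = lift (lift ord0 i) (lift ord0 j).
      by apply/val_inj; rewrite /= /bump !leq0n !add1n ltnS addnS.
    by rewrite tnth_tinsert_lift tnthS.
  by rewrite !tnth_tinsert.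
have -> : ord0 = lift (lift ord0 i) ord0 :> 'I_n.+2 by apply/val_inj.
rewrite tnth_tinsert_lift.
have -> : lift (lift ord0 i) ord0 = ord0 by apply/val_inj.
by rewrite !tnth0.
Qed.

Lemma measurable_tinsert {d} {T : measurableType d} {n} (i : 'I_n.+1) :
  measurable_fun [set: T * n.-tuple T] (fun z => tinsert i z.1 z.2).
Proof.
apply/measurable_fun_tnthP => k; case: (unliftP i k) => [j|] ->.
  rewrite (_ : _ \o _ = fun z : T * n.-tuple T => tnth z.2 j).
    exact: (measurableT_comp (measurable_tnth j)).
  by apply/funext => z /=; rewrite tnth_tinsert_lift.
by rewrite (_ : _ \o _ = fst)//; apply/funext => z /=; rewrite tnth_tinsert.
Qed.

(** [iid] draws coordinate 0 first; by exchangeability any coordinate may be. In the induction,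
    Tonelli swaps the head with the inserted coordinate, and [tinsert_tcons] moves the insertion
    past the head. *)
Lemma ge0_integral_iid_tinsert {d} {T : measurableType d} (m : probability T R) n
    (i : 'I_n.+1) (F : n.+1.-tuple T -> \bar R) :
  measurable_fun setT F -> (forall t, 0 <= F t) ->
  \int[iid n.+1 m]_t F t = \int[m]_x \int[iid n m]_t F (tinsert i x t).
Proof.
elim: n i F => [|n IH] i F mF F0.
  rewrite ord1 ge0_integral_iidS; [|by []|by []].
  by apply: eq_integral => x _; apply: eq_integral => t _; rewrite tinsert0.
case: (unliftP ord0 i) => [i'|] ->; last first.
  rewrite ge0_integral_iidS; [|by []|by []].
  by apply: eq_integral => x _; apply: eq_integral => t _; rewrite tinsert0.
rewrite ge0_integral_iidS; [|by []|by []].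
have mtc : measurable_fun setT (fun z : (T * T) * n.-tuple T =>
    F (tcons (z.1.1, tinsert i' z.1.2 z.2))).
  apply: (measurableT_comp mF); apply: measurable_fun_tcons; first by measurable_proj.
  apply: (measurableT_comp (measurable_tinsert i')
    (f := fun z : T * n.-tuple T => tinsert i' z.1 z.2)
    (g := fun z : (T * T) * n.-tuple T => (z.1.2, z.2))).
  by measurable_proj.
transitivity (\int[m]_y \int[m]_x \int[iid n m]_t F (tcons (y, tinsert i' x t))).
  apply: eq_integral => y _.
  apply: (IH i' (fun t => F (tcons (y, t)))) => //.
  by apply: (measurableT_comp mF); measurable_proj.
rewrite (fubini_tonelli (fun z : T * T =>
    \int[iid n m]_t F (tcons (z.1, tinsert i' z.2 t))))//; first last.
- by move=> z; exact: integral_ge0.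
- exact: (measurable_fun_fubini_tonelli_F _ mtc).
apply: eq_integral => x _.
rewrite (ge0_integral_iidS _ _ (fun t => F (tinsert (lift ord0 i') x t))); [| |by []].
  apply: eq_integral => y _; apply: eq_integral => t _.
  by rewrite tinsert_tcons.
apply: (measurableT_comp mF).
by apply: (measurableT_comp (measurable_tinsert (lift ord0 i'))
  (f := fun z : T * n.+1.-tuple T => tinsert _ z.1 z.2) (g := fun t => (x, t)));
  measurable_proj.
Qed.

Lemma measurable_map_fst {d1 d2} {T1 : measurableType d1} {T2 : measurableType d2} n :
  measurable_fun setT (fun t : n.-tuple (T1 * T2) => [tuple of [seq x.1 | x <- t]]).
Proof.
apply/measurable_fun_tnthP => j.
rewrite (_ : _ \o _ = fun t => (tnth t j).1).
  by apply: (measurableT_comp measurable_fst); exact: measurable_tnth.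
by apply/funext => t /=; rewrite tnth_map.
Qed.

Lemma measurable_map_snd {d1 d2} {T1 : measurableType d1} {T2 : measurableType d2} n :
  measurable_fun setT (fun t : n.-tuple (T1 * T2) => [tuple of [seq x.2 | x <- t]]).
Proof.
apply/measurable_fun_tnthP => j.
rewrite (_ : _ \o _ = fun t => (tnth t j).2).
  by apply: (measurableT_comp measurable_snd); exact: measurable_tnth.
by apply/funext => t /=; rewrite tnth_map.
Qed.

(** Separates the users' data from their seeds, so that the seeds can be summed on their own. In the
    induction, Tonelli exchanges the first seed with the remaining data. *)
Lemma ge0_integral_iid_prod {d1 d2} {T1 : measurableType d1} {T2 : measurableType d2}
    (m : probability T1 R) (rho : probability T2 R) n
    (F : n.-tuple T1 * n.-tuple T2 -> \bar R) :
  measurable_fun setT F -> (forall t, 0 <= F t) ->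
  \int[iid n (m \x rho : probability _ R)]_t
     F ([tuple of [seq x.1 | x <- t]], [tuple of [seq x.2 | x <- t]]) =
  \int[iid n m]_u \int[iid n rho]_r F (u, r).
Proof.
elim: n F => [|n IH] F mF F0.
  rewrite ge0_integral_iid0; last first.
    apply: (measurableT_comp mF); apply: measurable_fun_pair.
      exact: measurable_map_fst.
    exact: measurable_map_snd.
  rewrite ge0_integral_iid0; last exact: (measurable_fun_fubini_tonelli_F F).
  rewrite ge0_integral_iid0; last by apply: (measurableT_comp mF); measurable_proj.
  by congr F; congr pair; exact: tuple0.
rewrite ge0_integral_iidS//; last first.
  apply: (measurableT_comp mF); apply: measurable_fun_pair.
    exact: measurable_map_fst.
  exact: measurable_map_snd.
have mFF : measurable_fun setT (fun z : ((T1 * T2) * n.-tuple T1) * n.-tuple T2 =>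
    F (tcons (z.1.1.1, z.1.2), tcons (z.1.1.2, z.2))).
  by apply: (measurableT_comp mF); measurable_proj.
have mFF1 := measurable_fun_fubini_tonelli_F (m2 := iid n rho) _ mFF (fun=> F0 _).
have mFF2 : measurable_fun setT (fun x : T1 * T2 => \int[iid n m]_u \int[iid n rho]_r
    F (tcons (x.1, u), tcons (x.2, r))).
  apply: (measurable_fun_fubini_tonelli_F (fun z : (T1 * T2) * n.-tuple T1 =>
    \int[iid n rho]_r F (tcons (z.1.1, z.2), tcons (z.1.2, r)))); first exact: mFF1.
  by move=> z; exact: integral_ge0.
transitivity (\int[m \x rho]_x \int[iid n m]_u \int[iid n rho]_r
    F (tcons (x.1, u), tcons (x.2, r))).
  apply: eq_integral => -[x1 x2] _ /=.
  rewrite -(IH (fun z => F (tcons (x1, z.1), tcons (x2, z.2)))); [| |by []].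
    by apply: eq_integral => t _; congr F; congr pair; exact/val_inj.
  by apply: (measurableT_comp mF); measurable_proj.
rewrite fubini_tonelli1; [|exact: mFF2|]; last first.
  by move=> x; apply: integral_ge0 => u _; exact: integral_ge0.
rewrite ge0_integral_iidS; first last.
- by move=> x; apply: integral_ge0 => u _.
- exact: measurable_fun_fubini_tonelli_F.
apply: eq_integral => x _ /=.
rewrite /fubini_F/= (fubini_tonelli (fun z : T2 * n.-tuple T1 =>
    \int[iid n rho]_r F (tcons (x, z.2), tcons (z.1, r)))); first last.
- by move=> z; exact: integral_ge0.
- apply: (measurable_fun_fubini_tonelli_F (fun z : (T2 * n.-tuple T1) * n.-tuple T2 =>
    F (tcons (x, z.1.2), tcons (z.1.1, z.2)))) => //.
  by apply: (measurableT_comp mF); measurable_proj.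
apply: eq_integral => u _.
rewrite (ge0_integral_iidS _ _ (fun r => F (tcons (x, u), r))); [by []| |by []].
by apply: (measurableT_comp mF); measurable_proj.
Qed.

End iid_integrals.

(** * Gaussian vectors *)

Section tuple_sums.
Context {R : realType}.

Definition consr {s} (x : R) (z : s.-tuple R) : s.+1.-tuple R := [tuple of x :: z].

Lemma measurable_fun_consr {d} {T : measurableType d} {s}
    (f : T -> R) (g : T -> s.-tuple R) :
  measurable_fun setT f -> measurable_fun setT g ->
  measurable_fun setT (fun x => consr (f x) (g x)).
Proof. exact: measurable_cons. Qed.

Definition addt {s} (x y : s.-tuple R) : s.-tuple R :=
  [tuple tnth x j + tnth y j | j < s].

Definition sumt {n s} (t : n.-tuple (s.-tuple R)) : s.-tuple R :=
  [tuple \sum_(i < n) tnth (tnth t i) j | j < s].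

Lemma addtA {s} : associative (@addt s).
Proof. by move=> x y z; apply: eq_from_tnth => j; rewrite !tnth_mktuple addrA. Qed.

Lemma addt_consr {s} (x y : R) (u v : s.-tuple R) :
  addt (consr x u) (consr y v) = consr (x + y) (addt u v).
Proof.
apply: eq_from_tnth => k; case: (unliftP ord0 k) => [j|] ->.
  by rewrite tnth_mktuple !tnthS tnth_mktuple.
by rewrite tnth_mktuple !tnth0.
Qed.

Lemma add0_sumt {s} (t : 0.-tuple (s.-tuple R)) x : addt (sumt t) x = x.
Proof. by apply: eq_from_tnth => j; rewrite !tnth_mktuple big_ord0 add0r. Qed.

Lemma sumt_tcons {n s} (x : s.-tuple R) (t : n.-tuple (s.-tuple R)) :
  sumt (tcons (x, t)) = addt x (sumt t).
Proof.
apply: eq_from_tnth => j; rewrite !tnth_mktuple big_ord_recl tnth0; congr (_ + _).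
by apply: eq_bigr => i _; rewrite tnthS.
Qed.

Lemma measurable_addt {d} {T : measurableType d} {s} (f g : T -> s.-tuple R) :
  measurable_fun setT f -> measurable_fun setT g ->
  measurable_fun setT (fun x => addt (f x) (g x)).
Proof.
move=> mf mg; apply/measurable_fun_tnthP => j.
rewrite (_ : _ \o _ = fun x => tnth (f x) j + tnth (g x) j); last first.
  by apply/funext => x /=; rewrite tnth_mktuple.
by apply: measurable_funD; exact: (measurableT_comp (measurable_tnth j)).
Qed.

Lemma measurable_sumt {d} {T : measurableType d} {n s}
    (f : T -> n.-tuple (s.-tuple R)) :
  measurable_fun setT f -> measurable_fun setT (fun x => sumt (f x)).
Proof.
move=> mf; apply/measurable_fun_tnthP => j.
rewrite (_ : _ \o _ = fun x => \sum_(i < n) tnth (tnth (f x) i) j); last first.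
  by apply/funext => x /=; rewrite tnth_mktuple.
apply: measurable_sum => i; apply: (measurableT_comp (measurable_tnth j)).
exact: (measurableT_comp (measurable_tnth i)).
Qed.

Lemma measurable_EFin_expR {d} {T : measurableType d} (k : T -> R) :
  measurable_fun setT k ->
  measurable_fun setT (fun z => (expR (k z))%:E : \bar R).
Proof. by move=> mk; apply/measurable_EFinP; exact: measurableT_comp. Qed.

(* The logarithm of the density of N(a, v I) with respect to N(0, v I). *)
Definition gaussian_llr {s} (v : R) (a z : s.-tuple R) : R :=
  (\sum_(j < s) (tnth a j * tnth z j - tnth a j ^+ 2 / 2)) / v.

Lemma gaussian_llr_consr {s} v (a0 z0 : R) (a z : s.-tuple R) :
  gaussian_llr v (consr a0 a) (consr z0 z) = (a0 * z0 - a0 ^+ 2 / 2) / v + gaussian_llr v a z.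
Proof.
rewrite /gaussian_llr big_ord_recl !tnth0 mulrDl; congr (_ + _ / _).
by apply: eq_bigr => i _; rewrite !tnthS.
Qed.

Lemma measurable_gaussian_llr {d} {T : measurableType d} {s} v (f g : T -> s.-tuple R) :
  measurable_fun setT f -> measurable_fun setT g ->
  measurable_fun setT (fun x => gaussian_llr v (f x) (g x)).
Proof.
move=> mf mg; apply: measurable_funM => //.
apply: measurable_sum => j; apply: measurable_funB; last first.
  apply: measurable_funM => //; apply: measurable_funX.
  exact: (measurableT_comp (measurable_tnth j)).
by apply: measurable_funM; exact: (measurableT_comp (measurable_tnth j)).
Qed.

End tuple_sums.

Section gaussian_vectors.
Context {R : realType}.
Local Open Scope ereal_scope.

Lemma ge0_integral_gaussian_vec0 (v : R) (G : 0.-tuple R -> \bar R) :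
  measurable_fun setT G -> \int[gaussian_vec 0 v]_z G z = G [tuple].
Proof. exact: (@ge0_integral_iid0 _ _ _ (gaussian0 v)). Qed.

Lemma ge0_integral_gaussian_vecS {s} (v : R) (G : s.+1.-tuple R -> \bar R) :
  measurable_fun setT G -> (forall z, 0 <= G z) ->
  \int[gaussian_vec s.+1 v]_z G z =
  \int[gaussian0 v]_x \int[gaussian_vec s v]_z G (consr x z).
Proof. exact: (@ge0_integral_iidS _ _ _ (gaussian0 v)). Qed.

(** Coordinates convolve independently: Tonelli brings the two heads together, and induction treats
    the tails. *)
Lemma ge0_integral_gaussian_vec_conv {s} (a b : R) (G : s.-tuple R -> \bar R) :
  (0 <= a)%R -> (0 < b)%R -> measurable_fun setT G -> (forall z, 0 <= G z) ->
  \int[gaussian_vec s a]_x \int[gaussian_vec s b]_z G (addt x z) =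
  \int[gaussian_vec s (a + b)]_z G z.
Proof.
move=> a0 b0; elim: s G => [|s IH] G mG G0.
  rewrite [LHS]ge0_integral_gaussian_vec0; last first.
    apply: (measurable_fun_fubini_tonelli_F (fun z : 0.-tuple R * 0.-tuple R =>
      G (addt z.1 z.2))) => //.
    by apply: (measurableT_comp mG); apply: measurable_addt; measurable_proj.
  rewrite [LHS]ge0_integral_gaussian_vec0; last first.
    by apply: (measurableT_comp mG); apply: measurable_addt; measurable_proj.
  rewrite [RHS]ge0_integral_gaussian_vec0; last exact: mG.
  by congr G; exact: tuple0.
have mGG : measurable_fun setT (fun z : ((R * s.-tuple R) * R) * s.-tuple R =>
    G (consr (z.1.1.1 + z.1.2)%R (addt z.1.1.2 z.2))).
  apply: (measurableT_comp mG); apply: measurable_fun_consr.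
    by apply: measurable_funD; measurable_proj.
  by apply: measurable_addt; measurable_proj.
(* Halfway point: the tails are already merged into variance [a + b], the heads are not. *)
transitivity (\int[gaussian0 a]_x \int[gaussian0 b]_y
    \int[gaussian_vec s (a + b)]_z G (consr (x + y)%R z)); last first.
  rewrite [LHS](ge0_integral_gaussian0_conv _ _
    (fun c => \int[gaussian_vec s (a + b)]_z G (consr c z))); [|by []|by []| |].
  - by rewrite -ge0_integral_gaussian_vecS.
  - apply: (measurable_fun_fubini_tonelli_F (fun z : R * s.-tuple R =>
      G (consr z.1 z.2))) => //.
    by apply: (measurableT_comp mG); measurable_proj.
  - by move=> c; exact: integral_ge0.
rewrite [LHS]ge0_integral_gaussian_vecS; first last.
- by move=> x; exact: integral_ge0.
- apply: (measurable_fun_fubini_tonelli_F (fun z : s.+1.-tuple R * s.+1.-tuple R =>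
    G (addt z.1 z.2))) => //.
  by apply: (measurableT_comp mG); apply: measurable_addt; measurable_proj.
apply: eq_integral => x _.
transitivity (\int[gaussian_vec s a]_u \int[gaussian0 b]_y
    \int[gaussian_vec s b]_z G (consr (x + y)%R (addt u z))).
  apply: eq_integral => u _.
  rewrite [LHS](ge0_integral_gaussian_vecS _ (fun z => G (addt (consr x u) z))); [| |by []].
    by apply: eq_integral => y _; apply: eq_integral => z _; rewrite addt_consr.
  by apply: (measurableT_comp mG); apply: measurable_addt; measurable_proj.
rewrite [LHS](fubini_tonelli (fun p : s.-tuple R * R =>
    \int[gaussian_vec s b]_z G (consr (x + p.2)%R (addt p.1 z)))); first last.
- by move=> p; exact: integral_ge0.
- apply: (measurable_fun_fubini_tonelli_F (fun p : (s.-tuple R * R) * s.-tuple R =>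
    G (consr (x + p.1.2)%R (addt p.1.1 p.2)))) => //.
  apply: (measurableT_comp mG); apply: measurable_fun_consr.
    by apply: measurable_funD; measurable_proj.
  by apply: measurable_addt; measurable_proj.
apply: eq_integral => y _.
apply: (IH (fun z => G (consr (x + y)%R z))) => //.
by apply: (measurableT_comp mG); measurable_proj.
Qed.

(** Cameron-Martin in dimension [s]: the coordinates are independent, so the one-dimensional weights
    multiply and their logarithms add up to [gaussian_llr]. *)
Lemma ge0_integral_gaussian_vec_shift {s} (v : R) (a : s.-tuple R)
    (G : s.-tuple R -> \bar R) :
  (0 < v)%R -> measurable_fun setT G -> (forall z, 0 <= G z) ->
  \int[gaussian_vec s v]_z G (addt a z) =
  \int[gaussian_vec s v]_z (G z * (expR (gaussian_llr v a z))%:E).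
Proof.
move=> v0; elim: s a G => [|s IH] a G mG G0.
  rewrite [LHS]ge0_integral_gaussian_vec0; last first.
    by apply: (measurableT_comp mG); apply: measurable_addt; measurable_proj.
  rewrite [RHS]ge0_integral_gaussian_vec0; last first.
    apply: emeasurable_funM => //; apply/measurable_EFinP.
    by apply: measurableT_comp => //; apply: measurable_gaussian_llr; measurable_proj.
  rewrite /gaussian_llr big_ord0 mul0r expR0 mule1; congr G; exact: tuple0.
case/tupleP: a => a0 a; rewrite -[X in addt X]/(consr a0 a).
rewrite [LHS]ge0_integral_gaussian_vecS; [| |by []]; last first.
  by apply: (measurableT_comp mG); apply: measurable_addt; measurable_proj.
rewrite [RHS]ge0_integral_gaussian_vecS; first last.
- by move=> z; rewrite mule_ge0// lee_fin expR_ge0.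
- apply: emeasurable_funM => //; apply: measurable_EFin_expR.
  by apply: measurable_gaussian_llr; measurable_proj.
transitivity (\int[gaussian0 v]_x \int[gaussian_vec s v]_z
    (G (consr (a0 + x)%R z) * (expR (gaussian_llr v a z))%:E)).
  apply: eq_integral => x _; under eq_integral do rewrite addt_consr.
  apply: (IH a (fun z => G (consr (a0 + x)%R z))) => //.
  by apply: (measurableT_comp mG); measurable_proj.
have mH : measurable_fun setT (fun p : R * s.-tuple R =>
    G (consr p.1 p.2) * (expR (gaussian_llr v a p.2))%:E).
  apply: emeasurable_funM; first by apply: (measurableT_comp mG); measurable_proj.
  by apply: measurable_EFin_expR; apply: measurable_gaussian_llr; measurable_proj.
have H0 x z : 0 <= G (consr x z) * (expR (gaussian_llr v a z))%:E.
  by rewrite mule_ge0// lee_fin expR_ge0.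
rewrite [LHS](ge0_integral_gaussian0_shift _ _ (fun x => \int[gaussian_vec s v]_z
    (G (consr x z) * (expR (gaussian_llr v a z))%:E))); [|by []| |]; last 2 first.
- by apply: (measurable_fun_fubini_tonelli_F _ mH) => z; exact: H0.
- by move=> x; exact: integral_ge0.
apply: eq_integral => x _; rewrite -ge0_integralZr; first last.
- by rewrite lee_fin expR_ge0.
- by [].
- by apply: (measurableT_comp mH (g := fun z => (x, z))); measurable_proj.
- by [].
by apply: eq_integral => z _; rewrite gaussian_llr_consr -muleA -EFinM -expRD addrC.
Qed.

(** The privacy noises are absorbed one at a time. The noise being added is the summand whose
    variance may be 0; the accumulated variance [b + n%:R * a] is positive since [b] is. *)
Lemma ge0_integral_gaussian_vec_sum {n s} (a b : R) (G : s.-tuple R -> \bar R) :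
  (0 <= a)%R -> (0 < b)%R -> measurable_fun setT G -> (forall z, 0 <= G z) ->
  \int[iid n (gaussian_vec s a)]_r \int[gaussian_vec s b]_z G (addt (sumt r) z) =
  \int[gaussian_vec s (b + n%:R * a)]_z G z.
Proof.
move=> a0 b0; elim: n G => [|n IH] G mG G0.
  rewrite ge0_integral_iid0; last first.
    apply: (measurable_fun_fubini_tonelli_F
      (fun z : 0.-tuple (s.-tuple R) * s.-tuple R => G (addt (sumt z.1) z.2))) => //.
    apply: (measurableT_comp mG); apply: measurable_addt; last by measurable_proj.
    by apply: measurable_sumt; measurable_proj.
  by rewrite mul0r addr0; apply: eq_integral => z _; rewrite add0_sumt.
rewrite [LHS]ge0_integral_iidS; first last.
- by move=> r; exact: integral_ge0.
- apply: (measurable_fun_fubini_tonelli_F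
    (fun z : n.+1.-tuple (s.-tuple R) * s.-tuple R => G (addt (sumt z.1) z.2))) => //.
  apply: (measurableT_comp mG); apply: measurable_addt; last by measurable_proj.
  by apply: measurable_sumt; measurable_proj.
have -> : (b + n.+1%:R * a = a + (b + n%:R * a))%R by ring.
rewrite -[RHS]ge0_integral_gaussian_vec_conv; [|exact: a0| |exact: mG|exact: G0]; last first.
  by rewrite ltr_wpDr// mulr_ge0.
apply: eq_integral => r _.
under eq_integral do under eq_integral do rewrite sumt_tcons -addtA.
apply: (IH (fun z => G (addt r z))) => //.
by apply: (measurableT_comp mG); apply: measurable_addt; measurable_proj.
Qed.

(** Common source of the risk identity and of the information bound: a quantity that sees the seeds
    and the channel noise only through their sum sees a single Gaussian vector. *)
Lemma ge0_integral_sample_law {dU} {U : measurableType dU} {n s}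
    (m : probability U R) (a b : R) (G : n.-tuple U * s.-tuple R -> \bar R) :
  (0 <= a)%R -> (0 < b)%R -> measurable_fun setT G -> (forall z, 0 <= G z) ->
  \int[sample_law n s m (gaussian_vec s a) b]_w
    G ([tuple of [seq x.1 | x <- w.1]],
       addt (sumt [tuple of [seq x.2 | x <- w.1]]) w.2) =
  \int[iid n m]_u \int[gaussian_vec s (b + n%:R * a)]_z G (u, z).
Proof.
move=> a0 b0 mG G0.
rewrite [LHS]fubini_tonelli1; [| |by move=> w; exact: G0]; last first.
  apply: (measurableT_comp mG); apply: measurable_fun_pair.
    exact: (measurableT_comp (measurable_map_fst n)).
  apply: measurable_addt; last by measurable_proj.
  by apply: measurable_sumt; exact: (measurableT_comp (measurable_map_snd n)).
rewrite [LHS](ge0_integral_iid_prod _ _ _ (fun p => \int[gaussian_vec s b]_z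
    G (p.1, addt (sumt p.2) z))); first last.
- by move=> p; exact: integral_ge0.
- apply: (measurable_fun_fubini_tonelli_F (fun p :
    (n.-tuple U * n.-tuple (s.-tuple R)) * s.-tuple R =>
    G (p.1.1, addt (sumt p.1.2) p.2))) => //.
  apply: (measurableT_comp mG); apply: measurable_fun_pair; first by measurable_proj.
  by apply: measurable_addt; [apply: measurable_sumt|]; measurable_proj.
apply: eq_integral => u _.
rewrite [LHS](ge0_integral_gaussian_vec_sum _ _ (fun z => G (u, z)));
  [by []|by []|by []| |by []].
by apply: (measurableT_comp mG); measurable_proj.
Qed.

End gaussian_vectors.

(** * Conditional product laws and divergence *)

Section integral_complements.
Local Open Scope charge_scope.
Context {d} {T : measurableType d} {R : realType}.
Local Open Scope ereal_scope.

(** Positive parts increase and negative parts decrease from [f] to [g]. It serves for the log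
    density ratio, which is only bounded above by an integrable function. *)
Lemma measurable_le_integral (mu : {measure set T -> \bar R}) (f g : T -> \bar R) :
  measurable_fun setT f -> measurable_fun setT g -> (forall x, f x <= g x) ->
  \int[mu]_x f x <= \int[mu]_x g x.
Proof.
move=> mf mg fg; rewrite integralE [leRHS]integralE; apply: leeB.
  apply: ge0_le_integral => //; [exact: measurable_funepos|exact: measurable_funepos|].
  by move=> x _; apply: (@funepos_le _ _ setT) => //; rewrite inE.
apply: ge0_le_integral => //; [exact: measurable_funeneg|exact: measurable_funeneg|].
by move=> x _; apply: (@funeneg_le _ _ setT) => //; rewrite inE.
Qed.

(** [r] agrees with the Radon-Nikodym derivative [nu]-almost everywhere, and domination transfers
    this to [mu], against which the divergence integrates. *)
Lemma KL_density (mu nu : probability T R) (r : T -> R) :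
  measurable_fun setT r -> (forall x, (0 < r x)%R) ->
  (forall A, measurable A -> mu A = \int[nu]_(x in A) (r x)%:E) ->
  KL mu nu = \int[mu]_x (ln (r x))%:E.
Proof.
move=> mr r0 muE.
have mEr : measurable_fun setT (EFin \o r) by exact/measurable_EFinP.
have munu : mu `<< nu.
  apply/null_content_dominatesP => A mA nuA0; rewrite muE//.
  by apply: null_set_integral => //; exact: measurable_funTS.
rewrite /KL asboolT//.
have mRN : measurable_fun setT ('d (charge_of_finite_measure mu) '/d nu).
  by apply: measurable_int; exact: Radon_Nikodym_integrable.
have RNr : ae_eq nu setT ('d (charge_of_finite_measure mu) '/d nu) (EFin \o r).
  apply: integral_ae_eq => //; first exact: Radon_Nikodym_integrable.
  by move=> A _ mA; rewrite -Radon_Nikodym_integral//= -muE.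
apply: ae_eq_integral => //.
- apply/measurable_EFinP; apply: measurableT_comp; first exact: measurable_ln.
  exact: measurableT_comp.
- by apply/measurable_EFinP; apply: measurableT_comp; first exact: measurable_ln.
have /(null_dominates_ae_eq measurableT munu) := RNr.
by apply: filterS => x h Dx; rewrite h.
Qed.

End integral_complements.

Lemma ge0_integral_prod {d1 d2} {T1 : measurableType d1} {T2 : measurableType d2}
    {R : realType} (m1 : probability T1 R) (m2 : probability T2 R)
    (F : T1 * T2 -> \bar R) :
  measurable_fun setT F -> (forall x, 0 <= F x)%E ->
  (\int[(m1 \x m2)%E : probability _ R]_x F x =
   \int[m1]_x \int[m2]_y F (x, y))%E.
Proof. exact: fubini_tonelli1. Qed.

(** * The kernel of a map driven by independent noise *)

Section section_kernel.
Context {d1 d2 d3} {X : measurableType d1} {Y : measurableType d2}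
  {Z : measurableType d3} {R : realType}.
Variables (phi : {mfun (X * Y)%type >-> Z}) (pi : probability Y R).

Definition section_fun (x : X) (y : Y) : Z := phi (x, y).

Lemma measurable_section_fun x : measurable_fun setT (section_fun x).
Proof. by apply: (measurableT_comp (measurable_funP phi)); measurable_proj. Qed.

HB.instance Definition _ x :=
  isMeasurableFun.Build _ _ _ _ (section_fun x) (measurable_section_fun x).

(** An explicit regular conditional law: when [y] has law [pi] and is independent of [x], this is
    the law of [phi (x, y)] given [x]. *)
Definition section_kernel (x : X) : {measure set Z -> \bar R} :=
  distribution pi (section_fun x).

Lemma measurable_section_kernel (A : set Z) :
  measurable A -> measurable_fun setT (section_kernel ^~ A).
Proof.
move=> mA.
rewrite [X in measurable_fun _ X](_ : _ = pi \o xsection (phi @^-1` A)).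
  apply: measurable_fun_xsection.
  by rewrite -[X in measurable X]setTI; exact: (measurable_funP phi).
apply/funext => x /=; rewrite /section_kernel /distribution /pushforward/=.
congr (pi _); apply/seteqP; split => y /=; rewrite /xsection/= /section_fun.
  by move=> ?; rewrite inE.
by rewrite inE.
Qed.

HB.instance Definition _ :=
  isKernel.Build _ _ _ _ _ section_kernel measurable_section_kernel.

Lemma section_kernel_setT x : section_kernel x setT = 1%E.
Proof. exact: probability_setT. Qed.

HB.instance Definition _ :=
  Kernel_isProbability.Build _ _ _ _ _ section_kernel section_kernel_setT.

End section_kernel.

(** * The conditional product law for an input independent of the conditioning *)

Section independent_input.
Local Open Scope ereal_scope.
Context {R : realType} {dO d1 d2 d3 dW} {Omega : measurableType dO}
  {T1 : measurableType d1} {T2 : measurableType d2} {T3 : measurableType d3}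
  {W : measurableType dW}.
Variables (P : probability Omega R) (X : {mfun Omega >-> T1})
  (Y : {mfun Omega >-> T2}) (Z : {mfun Omega >-> T3}).
Variables (mY : probability T2 R) (mZ : probability T3 R) (mW : probability W R)
  (phi : {mfun (T3 * (T2 * W))%type >-> T1}).

(* Y, Z and the noise are independent, and X = phi (Z, (Y, noise)). *)
Hypothesis joint_law : forall F : T1 * (T2 * T3) -> \bar R,
  measurable_fun setT F -> (forall x, 0 <= F x) ->
  \int[P]_w F (X w, (Y w, Z w)) =
  \int[mZ]_t \int[mY]_u \int[mW]_z F (phi (t, (u, z)), (u, t)).

Let mphi : measurable_fun setT phi := measurable_funP phi.

(* The input of phi is replaced by an independent copy of Y. *)
Definition resample (x : T3 * (T2 * (T2 * W))) : T1 * (T2 * T3) :=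
  (phi (x.1, x.2.2), (x.2.1, x.1)).

Lemma measurable_resample : measurable_fun setT resample.
Proof.
by apply: measurable_fun_pair; [apply: (measurableT_comp mphi)|]; measurable_proj.
Qed.

HB.instance Definition _ :=
  isMeasurableFun.Build _ _ _ _ resample measurable_resample.

(** This is [P_{X|Z} P_{Y|Z} P_Z]: given [Z], the output comes from a fresh copy of [Y] and is
    therefore independent of the recorded one. *)
Definition resampled_law : probability (T1 * (T2 * T3))%type R :=
  distribution (mZ \x (mY \x (mY \x mW : probability _ R) : probability _ R)
    : probability _ R) resample.

Lemma ge0_integral_resampled (F : T1 * (T2 * T3) -> \bar R) :
  measurable_fun setT F -> (forall x, 0 <= F x) ->
  \int[resampled_law]_x F x =
  \int[mZ]_t \int[mY]_u \int[mY]_v \int[mW]_z F (phi (t, (v, z)), (u, t)).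
Proof.
move=> mF F0; rewrite ge0_integral_distribution//.
rewrite [LHS]ge0_integral_prod; [| |by move=> x; exact: F0]; last first.
  exact: (measurableT_comp mF).
apply: eq_integral => t _.
rewrite [LHS]ge0_integral_prod; [| |by move=> x; exact: F0]; last first.
  apply: (measurableT_comp mF); apply: measurable_fun_pair; last by measurable_proj.
  by apply: (measurableT_comp mphi); measurable_proj.
apply: eq_integral => u _.
rewrite [LHS]ge0_integral_prod; [by []| |by move=> x; exact: F0].
apply: (measurableT_comp mF); apply: measurable_fun_pair; last by measurable_proj.
by apply: (measurableT_comp mphi); measurable_proj.
Qed.

Let kX : R.-pker T3 ~> T1 := section_kernel phi (mY \x mW : probability _ R).
(** A constant kernel, because [Y] is independent of [Z]. *)
Let kY : R.-pker T3 ~> T2 :=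
  kprobability (@measurable_cst _ _ T3 (pprobability T2 R) setT mY).

Let int1 d (T : measurableType d) (Q : probability T R) (c : \bar R) :
  \int[Q]_x c = c.
Proof. by rewrite integral_cst// [X in _ * X]probability_setT mule1. Qed.

Let m1 d (T : measurableType d) (A : set T) : measurable A ->
  measurable_fun setT (fun x => (\1_A x)%:E : \bar R).
Proof. by move=> mA; apply/measurable_EFinP; exact: measurable_indic. Qed.

Let kXE t A : measurable A ->
  kX t A = \int[mY]_u \int[mW]_z (\1_A (phi (t, (u, z))))%:E.
Proof.
move=> mA.
rewrite -[RHS](ge0_integral_prod _ _ (fun x => (\1_A (phi (t, x)))%:E)); last 2 first.
- by apply: (measurableT_comp (m1 _ _ _ mA)); apply: (measurableT_comp mphi); measurable_proj.
- by move=> x; rewrite lee_fin.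
rewrite -[RHS](@ge0_integral_distribution _ _ _ _ _ _ (section_fun phi t)
  (fun y => (\1_A y)%:E)).
- by rewrite integral_indic// setIT.
- exact: m1.
- by move=> x; rewrite lee_fin.
Qed.

(** [joint_law] applied to functions of the last component shows that [Z] has law [mZ]. *)
Let integral_distributionZ (g : T3 -> \bar R) C :
  measurable C -> measurable_fun setT g -> (forall t, 0 <= g t) ->
  \int[distribution P Z]_(t in C) g t = \int[mZ]_t (g t * (\1_C t)%:E).
Proof.
move=> mC mg g0.
have mgC : measurable_fun setT (fun t => g t * (\1_C t)%:E).
  by apply: emeasurable_funM => //; exact: m1.
have gC0 t : 0 <= g t * (\1_C t)%:E by rewrite mule_ge0// lee_fin.
rewrite integral_mkcond epatch_indic.
rewrite [LHS]ge0_integral_distribution; [|exact: mgC|exact: gC0].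
rewrite [LHS](joint_law (fun x => g x.2.2 * (\1_C x.2.2)%:E)); first last.
- by move=> x; exact: gC0.
- by apply: (measurableT_comp mgC); measurable_proj.
by apply: eq_integral => t _; rewrite /= !int1.
Qed.

Let measure_indic2 A B C : measurable A -> measurable B -> measurable C ->
  P (X @^-1` A `&` (Y @^-1` B `&` Z @^-1` C)) =
  \int[mZ]_t \int[mY]_u \int[mW]_z
    ((\1_A (phi (t, (u, z))))%:E * ((\1_B u)%:E * (\1_C t)%:E)).
Proof.
move=> mA mB mC.
have mpre d (T : measurableType d) (V : {mfun Omega >-> T}) D : measurable D ->
    measurable (V @^-1` D).
  by move=> mD; rewrite -[X in measurable X]setTI; exact: (measurable_funP V).
rewrite -(joint_law (fun x =>
  (\1_A x.1)%:E * ((\1_B x.2.1)%:E * (\1_C x.2.2)%:E))); first last.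
- by move=> x; rewrite !mule_ge0// lee_fin.
- apply: emeasurable_funM; first by apply: (measurableT_comp (m1 _ _ _ mA)); measurable_proj.
  apply: emeasurable_funM; first by apply: (measurableT_comp (m1 _ _ _ mB)); measurable_proj.
  by apply: (measurableT_comp (m1 _ _ _ mC)); measurable_proj.
rewrite -[X in P X]setIT -integral_indic//; last first.
  by apply: measurableI; [|apply: measurableI]; exact: mpre.
by apply: eq_integral => w _; rewrite !indicI/= !EFinM.
Qed.

Let integral2Zr (h : T2 * W -> \bar R) (c : \bar R) :
  measurable_fun setT h -> (forall x, 0 <= h x) -> 0 <= c ->
  \int[mY]_u \int[mW]_z (h (u, z) * c) = (\int[mY]_u \int[mW]_z h (u, z)) * c.
Proof.
move=> mh h0 c0; rewrite -[RHS]ge0_integralZr//; first last.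
- by move=> u _; exact: integral_ge0.
- exact: (measurable_fun_fubini_tonelli_F h).
apply: eq_integral => u _; rewrite ge0_integralZr//.
by apply: (measurableT_comp mh); measurable_proj.
Qed.

(** On boxes everything is an integral of a product of indicators. For fixed [t], the integrals over
    the recorded copy and over the fresh copy with its noise separate, giving the factors [kY t B]
    and [kX t A]. *)
Lemma is_cond_product_resampled : is_cond_product P X Y Z resampled_law.
Proof.
have mkX A : measurable A -> measurable_fun setT (kX ^~ A).
  by move=> mA; exact: measurable_kernel.
have mAphi A t : measurable A ->
    measurable_fun setT (fun x : T2 * W => (\1_A (phi (t, x)))%:E : \bar R).
  move=> mA; apply: (measurableT_comp (m1 _ _ _ mA)).
  by apply: (measurableT_comp mphi); measurable_proj.
have indT T (x : T) : \1_[set: T] x = 1%R :> R by rewrite indicT.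
exists kX, kY; split.
- move=> A C mA mC.
  rewrite [RHS]integral_distributionZ; [|by []|exact: mkX|by []].
  (* The absent condition on [Y] is inserted as membership in the full set, so that the formula for
     boxes applies. *)
  rewrite -[X in _ `&` X]setTI -(preimage_setT Y) measure_indic2//.
  apply: eq_integral => t _; rewrite kXE//.
  rewrite -[RHS](integral2Zr (fun x => (\1_A (phi (t, x)))%:E)); first last.
  + by rewrite lee_fin.
  + by move=> x; rewrite lee_fin.
  + exact: mAphi.
  apply: eq_integral => u _; apply: eq_integral => z _.
  by rewrite indT mul1e.
- move=> B C mB mC.
  rewrite [RHS]integral_distributionZ; [|by []|exact: measurable_kernel|by []].
  rewrite -[X in P X]setTI -(preimage_setT X) measure_indic2//.
  apply: eq_integral => t _.
  rewrite -[kY t B]/(mY B) -[X in mY X]setIT -integral_indic//.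
  rewrite -[RHS]ge0_integralZr//; last exact: m1.
  apply: eq_integral => u _; rewrite -[RHS](int1 _ _ mW).
  by apply: eq_integral => z _; rewrite indT mul1e.
- move=> A B C mA mB mC.
  rewrite [RHS]integral_distributionZ//; last first.
    by apply: emeasurable_funM; [exact: mkX|exact: measurable_kernel].
  rewrite -[X in resampled_law X]setIT -integral_indic//; last first.
    by apply: measurableX => //; exact: measurableX.
  rewrite [LHS](ge0_integral_resampled (fun x => (\1_(A `*` (B `*` C)) x)%:E)); last 2 first.
  + by apply: m1; apply: measurableX => //; exact: measurableX.
  + by move=> x; rewrite lee_fin.
  apply: eq_integral => t _.
  rewrite -[kY t B]/(mY B) -[X in mY X]setIT -integral_indic// muleAC.
  rewrite -[RHS]ge0_integralZl//; last exact: m1.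
  apply: eq_integral => u _; rewrite -muleA kXE//.
  rewrite -[RHS](integral2Zr (fun x => (\1_A (phi (t, x)))%:E)); first last.
  + by rewrite mule_ge0// lee_fin.
  + by move=> x; rewrite lee_fin.
  + exact: mAphi.
  apply: eq_integral => v _; apply: eq_integral => z _.
  rewrite -!EFinM; congr EFin; rewrite !indicE !in_setX/=.
  by do 3 case: (_ \in _); rewrite ?(mul0r, mulr0, mul1r, mulr1).
Qed.

End independent_input.

(** * Information through a Gaussian channel *)

Section gaussian_coordinates.
Context {R : realType}.
Local Open Scope ereal_scope.
Variable v : R.
Hypothesis v0 : (0 < v)%R.

(** The density is even and Lebesgue measure is invariant under reflection. *)
Lemma ge0_integral_gaussian0N (g : R -> \bar R) :
  measurable_fun setT g -> (forall x, 0 <= g x) ->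
  \int[gaussian0 v]_x g (- x)%R = \int[gaussian0 v]_x g x.
Proof.
move=> mg g0.
rewrite [LHS]ge0_integral_gaussian0; [|exact: v0| |by move=> x; exact: g0]; last first.
  exact: measurableT_comp.
rewrite [RHS]ge0_integral_gaussian0; [|exact: v0|exact: mg|exact: g0].
pose h x := g x * (gaussian_density v x)%:E.
have mh : measurable_fun setT h.
  by apply: emeasurable_funM => //; apply/measurable_EFinP; exact: measurable_gaussian_density.
have h0 x : 0 <= h x by rewrite mule_ge0// lee_fin gaussian_density_ge0.
transitivity (\int[lebesgue_measure]_x h (- x)%R).
  by apply: eq_integral => x _; rewrite /h !gaussian_densityE// sqrrN.
pose phi (x : measurableTypeR R) : measurableTypeR R := (- x)%R.
have mphi : measurable_fun setT phi by exact: (@measurable_funN _ _ R setT id).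
transitivity (\int[pushforward lebesgue_measure phi]_x h x).
  by rewrite ge0_integral_pushforward// preimage_setT.
by apply: eq_measure_integral => A mA _; exact: lebesgue_measureN.
Qed.

(** Cameron-Martin for the constant 1 and the shift [a = v]: the weight is then [expR (x - v / 2)]
    and has integral 1. *)
Lemma integral_gaussian0_expR_lty : \int[gaussian0 v]_x (expR x)%:E < +oo.
Proof.
have me k : measurable_fun setT (fun x : R => (expR (x - k))%:E).
  by apply: measurable_EFin_expR; exact: measurable_funB.
have := ge0_integral_gaussian0_shift v v (cst 1) v0 (measurable_cst _) (fun=> lee01).
rewrite integral_cst// [X in _ * X]probability_setT mule1 => h.
have -> : \int[gaussian0 v]_x (expR x)%:E =
    \int[gaussian0 v]_x ((expR (v / 2))%:E * (1 * (expR ((v * x - v ^+ 2 / 2) / v))%:E)).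
  apply: eq_integral => x _; rewrite mul1e -EFinM -expRD; congr (expR _)%:E.
  by field; rewrite gt_eqF.
rewrite ge0_integralZl//.
- by rewrite -h mule1 ltry.
- apply: emeasurable_funM => //; apply: measurable_EFin_expR.
  by apply: measurable_funM => //; exact: measurable_funB.
Qed.

Lemma ge0_integral_gaussian_vec_tnth {s} (j : 'I_s) (g : R -> \bar R) :
  measurable_fun setT g -> (forall x, 0 <= g x) ->
  \int[gaussian_vec s v]_z g (tnth z j) = \int[gaussian0 v]_x g x.
Proof.
move=> mg g0; case: s j => [[]//|s] j.
have := @ge0_integral_iid_tinsert _ _ _ (gaussian0 v) s j (fun z => g (tnth z j)).
move=> -> //; last by apply: (measurableT_comp mg); exact: measurable_tnth.
apply: eq_integral => x _; under eq_integral do rewrite tnth_tinsert.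
by rewrite integral_cst// [X in _ * X]probability_setT mule1.
Qed.

(** [|x| <= expR x + expR (- x)] reduces the first moment to the exponential one. *)
Lemma integrable_gaussian_vec_tnth {s} (j : 'I_s) :
  (gaussian_vec s v).-integrable setT (fun z => (tnth z j)%:E).
Proof.
apply/integrableP; split.
  by apply/measurable_EFinP; exact: measurable_tnth.
rewrite (ge0_integral_gaussian_vec_tnth j (fun x => `|x%:E|)); last 2 first.
- by apply: measurableT_comp => //; exact/measurable_EFinP.
- by [].
have me : measurable_fun setT (fun x : R => (expR x)%:E).
  exact: measurable_EFin_expR.
have meN : measurable_fun setT (fun x : R => (expR (- x))%:E).
  by apply: measurable_EFin_expR; exact: measurable_funN.
apply: (@le_lt_trans _ _ (\int[gaussian0 v]_x ((expR x)%:E + (expR (- x))%:E))).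
  apply: ge0_le_integral => //.
  - by apply: measurableT_comp => //; exact/measurable_EFinP.
  - exact: emeasurable_funD.
  - move=> x _; rewrite -EFinD lee_fin ler_norml.
    have := expR_ge1Dx x; have := expR_ge1Dx (- x)%R.
    have := expR_ge0 x; have := expR_ge0 (- x)%R.
    by move=> ????; apply/andP; split; lra.
rewrite ge0_integralD//; try by move=> x _; rewrite lee_fin expR_ge0.
rewrite (ge0_integral_gaussian0N (fun x => (expR x)%:E))//.
by rewrite lte_add_pinfty//; exact: integral_gaussian0_expR_lty.
Qed.

(** Reflection exchanges the positive and negative parts; integrability makes their common integral
    finite, so that the difference is 0. *)
Lemma integral_gaussian_vec_tnth {s} (j : 'I_s) :
  \int[gaussian_vec s v]_z (tnth z j)%:E = 0.
Proof.
pose g (x : R) : \bar R := maxe x%:E 0.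
have mg : measurable_fun setT g by apply: measurable_maxe => //; exact/measurable_EFinP.
have g0 x : 0 <= g x by rewrite le_max lexx orbT.
rewrite integralE.
have -> : \int[gaussian_vec s v]_z (fun z => (tnth z j)%:E)^\- z =
          \int[gaussian_vec s v]_z (fun z => (tnth z j)%:E)^\+ z.
  transitivity (\int[gaussian_vec s v]_z g (- tnth z j)%R).
    by apply: eq_integral => z _; rewrite /g funenegE.
  rewrite (ge0_integral_gaussian_vec_tnth j (fun x => g (- x)%R))//; last first.
    exact: measurableT_comp.
  rewrite ge0_integral_gaussian0N// -(ge0_integral_gaussian_vec_tnth j)//.
  by apply: eq_integral => z _; rewrite /g funeposE.
rewrite subee//.
have := integrable_funepos measurableT (integrable_gaussian_vec_tnth j).
by move/integrable_fin_num; apply.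
Qed.

End gaussian_coordinates.

(** * Information between a Gaussian output and an independent input *)

Section gaussian_channel.
Local Open Scope ereal_scope.
Context {R : realType} {dO dU dT} {Omega : measurableType dO}
  {U : measurableType dU} {T : measurableType dT} {s : nat}.
Variables (P : probability Omega R) (X : {mfun Omega >-> s.-tuple R})
  (Y : {mfun Omega >-> U}) (Z : {mfun Omega >-> T}).
Variables (m : probability U R) (mT : probability T R) (v : R)
  (f : {mfun U >-> s.-tuple R}) (c : {mfun T >-> s.-tuple R}).
Hypothesis v0 : (0 < v)%R.

Definition channel_map (x : T * (U * s.-tuple R)) : s.-tuple R :=
  addt (c x.1) (addt (f x.2.1) x.2.2).

Let mf : measurable_fun setT f := measurable_funP f.
Let mc : measurable_fun setT c := measurable_funP c.

Lemma measurable_channel_map : measurable_fun setT channel_map.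
Proof.
apply: measurable_addt; first by apply: (measurableT_comp mc); measurable_proj.
by apply: measurable_addt; [apply: (measurableT_comp mf)|]; measurable_proj.
Qed.

HB.instance Definition _ :=
  isMeasurableFun.Build _ _ _ _ channel_map measurable_channel_map.

Hypothesis joint_law : forall F : s.-tuple R * (U * T) -> \bar R,
  measurable_fun setT F -> (forall x, 0 <= F x) ->
  \int[P]_w F (X w, (Y w, Z w)) =
  \int[mT]_t \int[m]_u \int[gaussian_vec s v]_z F (channel_map (t, (u, z)), (u, t)).

Local Notation gam := (gaussian_vec s v).

(* The output density with respect to [gam], once [c] is subtracted. *)
Let Q (z : s.-tuple R) : \bar R := \int[m]_u (expR (gaussian_llr v (f u) z))%:E.
Let q (z : s.-tuple R) : R := fine (Q z).

Let mE d (S : measurableType d) (g : S -> U) (h : S -> s.-tuple R) :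
  measurable_fun setT g -> measurable_fun setT h ->
  measurable_fun setT (fun x => (expR (gaussian_llr v (f (g x)) (h x)))%:E : \bar R).
Proof.
move=> mg mh; apply: measurable_EFin_expR; apply: measurable_gaussian_llr => //.
exact: (measurableT_comp mf).
Qed.

Let mQ : measurable_fun setT Q.
Proof.
apply: (measurable_fun_fubini_tonelli_F (fun x : s.-tuple R * U =>
  (expR (gaussian_llr v (f x.2) x.1))%:E)).
- by apply: mE; measurable_proj.
- by move=> x; rewrite lee_fin expR_ge0.
Qed.

Let mq : measurable_fun setT q.
Proof. exact: measurableT_comp. Qed.

(** If the integral of this positive function vanished, the function would be 0 outside a null set,
    which would then be the whole space, of probability 1. *)
Let Q_gt0 z : 0 < Q z.
Proof.
rewrite lt_neqAle integral_ge0 ?andbT; last by move=> u _; rewrite lee_fin expR_ge0.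
apply/eqP => Q0.
have mEz : measurable_fun setT (fun u => (expR (gaussian_llr v (f u) z))%:E : \bar R).
  by apply: mE; measurable_proj.
have : ae_eq m setT (fun u => (expR (gaussian_llr v (f u) z))%:E) (cst 0).
  apply/ae_eq_integral_abs => //; rewrite [RHS]Q0.
  by apply: eq_integral => u _; rewrite gee0_abs// lee_fin expR_ge0.
move=> [N [mN N0 NE]].
have NT : N = setT.
  apply/seteqP; split => // u _; apply: NE => /= /(_ I)[] /eqP.
  by rewrite gt_eqF// expR_gt0.
by move: N0; rewrite NT [X in X = _]probability_setT => /eqP; rewrite onee_eq0.
Qed.

(** [a z - a^2 / 2 <= z^2] coordinatewise bounds the integrand uniformly in [u]. *)
Let Q_fin z : Q z \is a fin_num.
Proof.
rewrite ge0_fin_numE; last exact: ltW.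
apply: (@le_lt_trans _ _ (\int[m]_u (expR ((\sum_(j < s) tnth z j ^+ 2) / v))%:E)).
  apply: ge0_le_integral => //.
  - by apply: mE; measurable_proj.
  move=> u _; rewrite lee_fin ler_expR ler_pM2r ?invr_gt0//.
  apply: ler_sum => j _.
  have := sqr_ge0 (tnth (f u) j - tnth z j); have := sqr_ge0 (tnth z j).
  rewrite sqrrB => *; lra.
by rewrite integral_cst// [X in _ * X]probability_setT mule1 ltry.
Qed.

Let QE z : Q z = (q z)%:E.
Proof. by rewrite fineK. Qed.

Let q_gt0 z : (0 < q z)%R.
Proof. by rewrite -lte_fin -QE. Qed.

Definition subt (x y : s.-tuple R) : s.-tuple R :=
  [tuple tnth x j - tnth y j | j < s]%R.

Let addtK x y : subt (addt x y) x = y.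
Proof. by apply: eq_from_tnth => j; rewrite !tnth_mktuple addrC addKr. Qed.

Let measurable_subt d (S : measurableType d) (g h : S -> s.-tuple R) :
  measurable_fun setT g -> measurable_fun setT h ->
  measurable_fun setT (fun x => subt (g x) (h x)).
Proof.
move=> mg mh; apply/measurable_fun_tnthP => j.
rewrite (_ : _ \o _ = fun x => tnth (g x) j - tnth (h x) j)%R; last first.
  by apply/funext => x /=; rewrite tnth_mktuple.
by apply: measurable_funB; exact: (measurableT_comp (measurable_tnth j)).
Qed.

(** The density of the joint law with respect to [nu]: the output density given the input over the
    output density averaged over inputs, both given the other users. *)
Let r (x : s.-tuple R * (U * T)) : R :=
  (expR (gaussian_llr v (f x.2.1) (subt x.1 (c x.2.2))) / q (subt x.1 (c x.2.2)))%R.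

Let msub : measurable_fun setT
  (fun x : s.-tuple R * (U * T) => subt x.1 (c x.2.2)).
Proof. by apply: measurable_subt; [|apply: (measurableT_comp mc)]; measurable_proj. Qed.

Let mqV d (S : measurableType d) (g : S -> s.-tuple R) : measurable_fun setT g ->
  measurable_fun setT (fun x => (q (g x))^-1)%R.
Proof.
(* [q] is positive, so its inverse is [expR (- ln q)], a composition of measurable functions. *)
move=> mg; rewrite (_ : (fun _ => _) = (fun x => expR (- ln (q (g x))))%R).
  apply: measurableT_comp => //; apply: measurable_funN.
  apply: measurableT_comp; first exact: measurable_ln.
  exact: (measurableT_comp mq).
by apply/funext => x; rewrite expRN lnK// posrE.
Qed.

Let mr : measurable_fun setT r.
Proof.
apply: measurable_funM; last exact: mqV.
apply/measurable_EFinP; apply: (mE _ _ (fun x => x.2.1)) => //.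
by measurable_proj.
Qed.

Let r_gt0 x : (0 < r x)%R.
Proof. by rewrite divr_gt0// expR_gt0. Qed.

Let mP : probability _ R := distribution P (joint3 X Y Z).
Let nu : probability _ R := resampled_law m mT gam channel_map.

Let ge0_integral_mP (F : s.-tuple R * (U * T) -> \bar R) :
  measurable_fun setT F -> (forall x, 0 <= F x) ->
  \int[mP]_x F x =
  \int[mT]_t \int[m]_u \int[gam]_z F (channel_map (t, (u, z)), (u, t)).
Proof.
move=> mF F0; rewrite -joint_law//.
by rewrite [LHS]ge0_integral_distribution.
Qed.

(** The recorded input [u] and the transmitted input [w] are kept apart: [w = u] serves the joint
    law, a fresh [w] the resampled one. *)
Let shift_channel (F : s.-tuple R * (U * T) -> \bar R) t u w :
  measurable_fun setT F -> (forall x, 0 <= F x) ->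
  \int[gam]_z F (channel_map (t, (w, z)), (u, t)) =
  \int[gam]_z (F (addt (c t) z, (u, t)) * (expR (gaussian_llr v (f w) z))%:E).
Proof.
move=> mF F0.
apply: (ge0_integral_gaussian_vec_shift v (f w) (fun z => F (addt (c t) z, (u, t)))) => //.
apply: (measurableT_comp mF); apply: measurable_fun_pair; last by measurable_proj.
by apply: measurable_addt; measurable_proj.
Qed.

(** After the shift, both sides integrate against [gam]. On the resampled side only the weight
    depends on the fresh input; integrating it out produces [Q z], which cancels the denominator of
    [r]. *)
Let mP_density A : measurable A -> mP A = \int[nu]_(x in A) (r x)%:E.
Proof.
move=> mA.
have m1A : measurable_fun setT (fun x => (\1_A x)%:E : \bar R).
  by apply/measurable_EFinP; exact: measurable_indic.
have mrA : measurable_fun setT (fun x => (r x)%:E * (\1_A x)%:E).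
  by apply: emeasurable_funM => //; exact/measurable_EFinP.
have rA0 x : 0 <= (r x)%:E * (\1_A x)%:E by rewrite mule_ge0 ?lee_fin// ltW.
rewrite integral_mkcond epatch_indic.
rewrite [RHS]ge0_integral_resampled; [|exact: mrA|exact: rA0].
rewrite -[X in mP X]setIT -integral_indic//.
rewrite [LHS]ge0_integral_mP; [|exact: m1A|by move=> x; rewrite lee_fin].
apply: eq_integral => t _; apply: eq_integral => u _.
rewrite [LHS](shift_channel (fun x => (\1_A x)%:E));
  [|exact: m1A|by move=> x; rewrite lee_fin].
transitivity (\int[m]_w \int[gam]_z ((r (addt (c t) z, (u, t)))%:E *
    (\1_A (addt (c t) z, (u, t)))%:E * (expR (gaussian_llr v (f w) z))%:E)); last first.
  apply: eq_integral => w _.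
  by rewrite [RHS](shift_channel (fun x => (r x)%:E * (\1_A x)%:E)).
have mb : measurable_fun setT (fun z => (r (addt (c t) z, (u, t)))%:E *
    (\1_A (addt (c t) z, (u, t)))%:E : \bar R).
  apply: (measurableT_comp mrA (g := fun z => (addt (c t) z, (u, t)))).
  by apply: measurable_fun_pair; [apply: measurable_addt|]; measurable_proj.
rewrite [RHS](fubini_tonelli (fun x : U * s.-tuple R =>
  (r (addt (c t) x.2, (u, t)))%:E *
    (\1_A (addt (c t) x.2, (u, t)))%:E * (expR (gaussian_llr v (f x.1) x.2))%:E)); first last.
- by move=> x; rewrite mule_ge0// lee_fin expR_ge0.
- apply: emeasurable_funM; first by apply: (measurableT_comp mb); measurable_proj.
  by apply: mE; measurable_proj.
apply: eq_integral => z _; rewrite /=.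
rewrite [RHS]ge0_integralZl; first last.
- exact: rA0.
- by move=> w _; rewrite lee_fin expR_ge0.
- by apply: mE; measurable_proj.
- by [].
rewrite -/(Q z) QE /r/= addtK -!EFinM; congr EFin.
by rewrite mulrAC divfK ?gt_eqF// mulrC.
Qed.

Let cond_mutual_infoE_le : cond_mutual_info P X Y Z <= \int[mP]_x (ln (r x))%:E.
Proof.
rewrite -(KL_density mP nu r mr r_gt0 mP_density).
apply: ereal_inf_lbound; exists nu => //.
exact: is_cond_product_resampled.
Qed.

Let lam : probability (U * s.-tuple R)%type R := m \x gam.

(** Once [c t] is subtracted from the output, the quantities of interest depend on the input and the
    noise alone; [t] integrates out. *)
Let ge0_integral_lam (G : U * s.-tuple R -> \bar R) (F : s.-tuple R * (U * T) -> \bar R) :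
  measurable_fun setT G -> measurable_fun setT F ->
  (forall x, 0 <= F x) -> (forall x, 0 <= G x) ->
  (forall t u z, F (channel_map (t, (u, z)), (u, t)) = G (u, z)) ->
  \int[mP]_x F x = \int[lam]_x G x.
Proof.
move=> mG mF F0 G0 FG.
rewrite [LHS]ge0_integral_mP; [|exact: mF|exact: F0].
rewrite [RHS]ge0_integral_prod; [|exact: mG|exact: G0].
transitivity (\int[mT]_t \int[m]_u \int[gam]_z G (u, z)); last first.
  rewrite [LHS]integral_cst; last by [].
  by rewrite [X in _ * X]probability_setT mule1.
apply: eq_integral => t _; apply: eq_integral => u _.
by apply: eq_integral => z _; rewrite FG.
Qed.

Let integral_lam (G : U * s.-tuple R -> \bar R) (F : s.-tuple R * (U * T) -> \bar R) :
  measurable_fun setT G -> measurable_fun setT F ->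
  (forall t u z, F (channel_map (t, (u, z)), (u, t)) = G (u, z)) ->
  \int[mP]_x F x = \int[lam]_x G x.
Proof.
move=> mG mF FG; rewrite integralE [RHS]integralE; congr (_ - _).
  apply: ge0_integral_lam => //; [exact: measurable_funepos|exact: measurable_funepos|].
  by move=> t u z; rewrite !funeposE FG.
apply: ge0_integral_lam => //; [exact: measurable_funeneg|exact: measurable_funeneg|].
by move=> t u z; rewrite !funenegE FG.
Qed.

Variable K : R.
Hypothesis power : \sum_(j < s) \int[m]_u ((tnth (f u) j) ^+ 2)%:E <= K%:E.

Let mfj j : measurable_fun setT (fun u => tnth (f u) j).
Proof. exact: (measurableT_comp (measurable_tnth j)). Qed.

(** [|x| <= 1 + x^2], and the power bound controls the second moment. *)
Let integrable_fj j : m.-integrable setT (fun u => (tnth (f u) j)%:E).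
Proof.
apply/integrableP; split; first exact/measurable_EFinP.
have msq : measurable_fun setT (fun u => ((tnth (f u) j) ^+ 2)%:E : \bar R).
  by apply/measurable_EFinP; exact: measurable_funX.
apply: (@le_lt_trans _ _ (\int[m]_u (1 + ((tnth (f u) j) ^+ 2)%:E))).
  apply: ge0_le_integral => //.
  - by apply: measurableT_comp => //; exact/measurable_EFinP.
  - exact: emeasurable_funD.
  - move=> u _; rewrite -EFinD lee_fin ler_norml.
    have := sqr_ge0 (tnth (f u) j - 1); have := sqr_ge0 (tnth (f u) j + 1).
    rewrite sqrrB sqrrD => *; apply/andP; split; lra.
rewrite ge0_integralD//; last by move=> u _; rewrite lee_fin sqr_ge0.
rewrite integral_cst// [X in _ * X]probability_setT mule1 lte_add_pinfty ?ltry//.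
apply: le_lt_trans (le_lt_trans power (ltry _)).
rewrite (bigD1 j)//= leeDl// sume_ge0// => k _.
by apply: integral_ge0 => u _; rewrite lee_fin sqr_ge0.
Qed.

(** At [a + z] the exponent [a (a + z) - a^2 / 2] becomes [a z + a^2 / 2]: [cross] is the first
    term, [energy] below collects the second, divided by [v]. *)
Let cross j (x : U * s.-tuple R) : R := (tnth (f x.1) j * tnth x.2 j)%R.

Let mcross j : measurable_fun setT (cross j).
Proof.
apply: measurable_funM; first by apply: (measurableT_comp (mfj j)); measurable_proj.
by apply: (measurableT_comp (measurable_tnth j)); measurable_proj.
Qed.

(** By independence the absolute moment factors into those of the signal and of the noise, both
    finite. *)
Let integrable_cross j : lam.-integrable setT (EFin \o cross j).
Proof.
apply/(integrable12ltyP m gam); first exact/measurable_EFinP.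
have /integrableP[mz iz] := integrable_gaussian_vec_tnth v v0 j.
have /integrableP[mfu ifu] := integrable_fj j.
under eq_integral.
  move=> u _.
  under eq_integral do rewrite /= /cross /= normrM EFinM.
  rewrite ge0_integralZl//; last first.
    by apply/measurable_EFinP; apply: measurableT_comp => //; exact: measurable_tnth.
  over.
rewrite ge0_integralZr//; last 2 first.
- by apply/measurable_EFinP; exact: measurableT_comp.
- exact: integral_ge0.
apply: lte_mul_pinfty => //; first exact: integral_ge0.
by rewrite ge0_fin_numE//; exact: integral_ge0.
Qed.

(** Fubini integrates the centred noise first. *)
Let integral_cross j : \int[lam]_x (cross j x)%:E = 0.
Proof.
rewrite -[LHS](integral12_prod_meas1 (integrable_cross j)) /fubini_F/=.
rewrite -[RHS](integral0 m setT); apply: eq_integral => u _.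
under eq_integral do rewrite /cross /= EFinM.
rewrite integralZl//; last exact: integrable_gaussian_vec_tnth.
by rewrite integral_gaussian_vec_tnth// mule0.
Qed.

Let energy (x : U * s.-tuple R) : R :=
  ((\sum_(j < s) tnth (f x.1) j ^+ 2) / (2 * v))%R.

Let menergy : measurable_fun setT energy.
Proof.
apply: measurable_funM => //; apply: measurable_sum => j; apply: measurable_funX.
by apply: (measurableT_comp (mfj j)); measurable_proj.
Qed.

Let energy_ge0 x : (0 <= energy x)%R.
Proof. by rewrite divr_ge0 ?sumr_ge0// => [j _|]; rewrite ?sqr_ge0// mulr_ge0// ltW. Qed.

Let integral_energy_le : \int[lam]_x (energy x)%:E <= (K / (2 * v))%:E.
Proof.
have mf2 j : measurable_fun setT (fun u => ((tnth (f u) j) ^+ 2)%:E : \bar R).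
  by apply/measurable_EFinP; exact: measurable_funX.
have f20 j u : 0 <= ((tnth (f u) j) ^+ 2)%:E by rewrite lee_fin sqr_ge0.
rewrite [leLHS]ge0_integral_prod; [|exact/measurable_EFinP|by move=> x; rewrite lee_fin].
have -> : \int[m]_u \int[gam]_z (energy (u, z))%:E =
    \int[m]_u ((\sum_(j < s) ((tnth (f u) j) ^+ 2)%:E) * ((2 * v)^-1)%:E).
  apply: eq_integral => u _; rewrite /energy/= [LHS]integral_cst; last by [].
  by rewrite [X in _ * X]probability_setT mule1 EFinM sumEFin.
rewrite ge0_integralZr; first last.
- by rewrite lee_fin invr_ge0 mulr_ge0// ltW.
- by move=> u _; exact: sume_ge0.
- exact: emeasurable_sum.
- by [].
rewrite ge0_integral_sum//.
by rewrite EFinM lee_wpmul2r// lee_fin invr_ge0 mulr_ge0// ltW.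
Qed.

Let invq (x : U * s.-tuple R) : R := ((q (addt (f x.1) x.2))^-1)%R.

Let minvq : measurable_fun setT invq.
Proof.
by apply: mqV; apply: measurable_addt; [apply: (measurableT_comp mf)|]; measurable_proj.
Qed.

Let invq_ge0 x : (0 <= invq x)%R.
Proof. by rewrite invr_ge0 ltW. Qed.

(** The law of [f u + z] has density [q] with respect to [gam], so the mean of [1 / q] is the
    integral of [q / q]. *)
Let integral_invq : \int[lam]_x (invq x)%:E = 1.
Proof.
have mqE : measurable_fun setT (fun z => (q z)^-1%:E : \bar R).
  by apply/measurable_EFinP; apply: mqV; measurable_proj.
rewrite [LHS]ge0_integral_prod; [|exact/measurable_EFinP|by move=> x; rewrite lee_fin].
transitivity (\int[m]_u \int[gam]_z ((q z)^-1%:E * (expR (gaussian_llr v (f u) z))%:E)).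
  apply: eq_integral => u _.
  apply: (ge0_integral_gaussian_vec_shift v (f u) (fun z => (q z)^-1%:E)) => //.
  by move=> z; rewrite lee_fin invr_ge0 ltW.
rewrite [LHS](fubini_tonelli (fun x : U * s.-tuple R =>
  (q x.2)^-1%:E * (expR (gaussian_llr v (f x.1) x.2))%:E)); first last.
- by move=> x; rewrite mule_ge0// lee_fin ?expR_ge0// invr_ge0 ltW.
- apply: emeasurable_funM; first by apply: (measurableT_comp mqE); measurable_proj.
  by apply: mE; measurable_proj.
transitivity (\int[gam]_z (cst 1 z : \bar R)); last first.
  by rewrite integral_cst// [X in _ * X]probability_setT mule1.
apply: eq_integral => z _ /=.
rewrite ge0_integralZl; first last.
- by rewrite lee_fin invr_ge0 ltW.
- by move=> w _; rewrite lee_fin expR_ge0.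
- by apply: mE; measurable_proj.
- by [].
by rewrite -/(Q z) QE -EFinM mulVf// gt_eqF.
Qed.

Let logr (x : U * s.-tuple R) : R :=
  (gaussian_llr v (f x.1) (addt (f x.1) x.2) - ln (q (addt (f x.1) x.2)))%R.

Let mlogr : measurable_fun setT logr.
Proof.
have ma : measurable_fun setT (fun x : U * s.-tuple R => addt (f x.1) x.2).
  by apply: measurable_addt; [apply: (measurableT_comp mf)|]; measurable_proj.
apply: measurable_funB.
  by apply: measurable_gaussian_llr => //; apply: (measurableT_comp mf); measurable_proj.
apply: measurableT_comp; first exact: measurable_ln.
exact: (measurableT_comp mq).
Qed.

(** An integrable majorant of [logr], whose expectation can be taken term by term: the cross terms
    and [invq x - 1] have mean 0, leaving the energy. *)
Let bound (x : U * s.-tuple R) : R :=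
  ((\sum_(j < s) cross j x) / v + (energy x + (invq x - 1)))%R.

Let logr_le x : (logr x <= bound x)%R.
Proof.
rewrite /bound addrA; apply: lerD.
  rewrite /gaussian_llr /energy invfM mulrA -mulrDl ler_pM2r ?invr_gt0//.
  rewrite mulr_suml -big_split/=; apply: ler_sum => j _.
  by rewrite tnth_mktuple /cross; lra.
(* [1 + y <= expR y] at [y = - ln q]. *)
rewrite -lnV ?posrE// lerBrDl.
by rewrite (le_trans (expR_ge1Dx _))// lnK// posrE invr_gt0.
Qed.

Let integrable_of_ge0 (g : U * s.-tuple R -> R) (k : R) :
  measurable_fun setT g -> (forall x, (0 <= g x)%R) ->
  \int[lam]_x (g x)%:E <= k%:E -> lam.-integrable setT (EFin \o g).
Proof.
move=> mg g0 gk; apply/integrableP; split; first exact/measurable_EFinP.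
apply: le_lt_trans (le_lt_trans gk (ltry _)).
by under eq_integral do rewrite /= ger0_norm//.
Qed.

Let integral_bound_le : \int[lam]_x (bound x)%:E <= (K / (2 * v))%:E.
Proof.
have icross : lam.-integrable setT (fun x => (v^-1)%:E * \sum_(j < s) (cross j x)%:E).
  apply: integrableZl => //.
  by apply: integrable_sum => // j _; exact: integrable_cross.
have ienergy := integrable_of_ge0 _ _ menergy energy_ge0 integral_energy_le.
have iinvq : lam.-integrable setT (EFin \o invq).
  apply: (integrable_of_ge0 _ 1%R) => //.
  by rewrite integral_invq.
have iinvq1 : lam.-integrable setT (fun x => (invq x)%:E - 1).
  by apply: integrableB => //; exact: finite_measure_integrable_cst.
have boundE x : (bound x)%:E = ((v^-1)%:E * \sum_(j < s) (cross j x)%:E) +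
    ((energy x)%:E + ((invq x)%:E - 1)).
  by rewrite /bound mulrC EFinD EFinM sumEFin EFinD EFinB.
under eq_integral do rewrite boundE.
rewrite integralD//; last exact: integrableD.
rewrite integralD// integralB//; last exact: finite_measure_integrable_cst.
rewrite integralZl//; last by apply: integrable_sum => // j _; exact: integrable_cross.
rewrite integral_sum//.
rewrite big1 ?mule0 ?add0e; last by move=> j _; exact: integral_cross.
rewrite integral_invq integral_cst// [X in _ - _ * X]probability_setT mule1.
by rewrite subee// adde0.
Qed.

Lemma cond_mutual_info_gaussian_le : cond_mutual_info P X Y Z <= (K / (2 * v))%:E.
Proof.
apply: (le_trans cond_mutual_infoE_le); apply: le_trans integral_bound_le.
rewrite (integral_lam (fun x => (logr x)%:E)).
- apply: measurable_le_integral.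
  + exact/measurable_EFinP.
  + apply/measurable_EFinP; apply: measurable_funD.
      by apply: measurable_funM => //; exact: measurable_sum.
    by apply: measurable_funD => //; exact: measurable_funB.
  + by move=> x; rewrite lee_fin.
- exact/measurable_EFinP.
- by apply/measurable_EFinP; apply: measurableT_comp; first exact: measurable_ln.
- move=> t u z; rewrite /r/= addtK lnM ?posrE ?expR_gt0 ?invr_gt0//.
  by rewrite expRK lnV ?posrE.
Qed.

End gaussian_channel.

(** * The over-the-air scheme *)

Section encoder_sum.
Context {R : realType} {dU} {U : measurableType dU} {s : nat}.
Variable f : {mfun U >-> s.-tuple R}.

Definition sumf {n} (u : n.-tuple U) : s.-tuple R :=
  sumt [tuple of [seq f x | x <- u]].

Lemma sumfE {n} (u : n.-tuple U) j : tnth (sumf u) j = \sum_(i < n) tnth (f (tnth u i)) j.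
Proof. by rewrite tnth_mktuple; apply: eq_bigr => i _; rewrite tnth_map. Qed.

Lemma measurable_sumf n : measurable_fun setT (@sumf n).
Proof.
apply: measurable_sumt; apply/measurable_fun_tnthP => i.
rewrite (_ : _ \o _ = fun u => f (tnth u i)); last first.
  by apply/funext => u /=; rewrite tnth_map.
exact: (measurableT_comp (measurable_funP f) (measurable_tnth i)).
Qed.

HB.instance Definition _ n :=
  isMeasurableFun.Build _ _ _ _ (@sumf n) (measurable_sumf n).

Lemma sumf_tinsert {n} (i : 'I_n.+1) (x : U) (t : n.-tuple U) :
  sumf (tinsert i x t) = addt (sumf t) (f x).
Proof.
apply: eq_from_tnth => j.
rewrite sumfE (bigD1_ord i)//= tnth_tinsert tnth_mktuple sumfE addrC.
by congr (_ + _); apply: eq_bigr => k _; rewrite tnth_tinsert_lift.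
Qed.

(** Gathers the noiseless signals on one side and all the noises on the other, the shape treated by
    [ge0_integral_sample_law]. *)
Lemma received_robust {n} (w : n.-tuple (U * s.-tuple R) * s.-tuple R) :
  received (robust_encoder f) w =
  addt (sumf [tuple of [seq x.1 | x <- w.1]])
       (addt (sumt [tuple of [seq x.2 | x <- w.1]]) w.2).
Proof.
apply: eq_from_tnth => j; rewrite !tnth_mktuple addrA -big_split/=; congr (_ + _).
by apply: eq_bigr => i _; rewrite !tnth_map tnth_ord_tuple.
Qed.

Lemma received_det {n} (w : n.-tuple (U * unit) * s.-tuple R) :
  received (det_encoder f) w = addt (sumf [tuple of [seq x.1 | x <- w.1]]) w.2.
Proof.
apply: eq_from_tnth => j; rewrite !tnth_mktuple; congr (_ + _).
by apply: eq_bigr => i _; rewrite !tnth_map.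
Qed.

End encoder_sum.

Section risk.
Local Open Scope ereal_scope.
Context {R : realType} {dU} {U : measurableType dU} {d n s : nat}.
Variables (p : d.-tuple R -> probability U R) (f : {mfun U >-> s.-tuple R})
  (est : {mfun s.-tuple R >-> d.-tuple R}) (theta : d.-tuple R).

Let G (x : n.-tuple U * s.-tuple R) : \bar R :=
  (sqdist (est (addt (sumf f x.1) x.2)) theta)%:E.

Let mG : measurable_fun setT G.
Proof.
apply/measurable_EFinP; apply: measurable_sum => k; apply: measurable_funX.
apply: measurable_funB => //.
apply: (measurableT_comp (measurable_tnth k)).
apply: (measurableT_comp (measurable_funP est)).
by apply: measurable_addt; [apply: (measurableT_comp (measurable_sumf f n))|]; measurable_proj.
Qed.

Let G0 x : 0 <= G x.
Proof. by rewrite lee_fin sumr_ge0// => k _; rewrite sqr_ge0. Qed.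

Lemma risk_robust (a b : R) : (0 <= a)%R -> (0 < b)%R ->
  risk n p (gaussian_vec s a) (robust_encoder f) b est theta =
  \int[iid n (p theta)]_u \int[gaussian_vec s (b + n%:R * a)]_z G (u, z).
Proof.
move=> a0 b0.
rewrite -[RHS]ge0_integral_sample_law; [|exact: a0|exact: b0|exact: mG|exact: G0].
by apply: eq_integral => w _; rewrite received_robust.
Qed.

(** The trivial seeds integrate out, leaving the integral of [risk_robust] with the whole noise
    variance placed in the channel. *)
Lemma risk_det (b : R) :
  risk n p no_seed (det_encoder f) b est theta =
  \int[iid n (p theta)]_u \int[gaussian_vec s b]_z G (u, z).
Proof.
pose H (x : n.-tuple U * n.-tuple unit) := \int[gaussian_vec s b]_z G (x.1, z).
have mH : measurable_fun setT H.
  apply: (measurable_fun_fubini_tonelli_F (fun x :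
    (n.-tuple U * n.-tuple unit) * s.-tuple R => G (x.1.1, x.2))) => //.
  by apply: (measurableT_comp mG); measurable_proj.
have H0 x : 0 <= H x by exact: integral_ge0.
transitivity (\int[iid n (p theta)]_u
    \int[iid n (no_seed : probability unit R)]_r H (u, r)); last first.
  apply: eq_integral => u _; rewrite /H/= [LHS]integral_cst; last by [].
  by rewrite [X in _ * X]probability_setT mule1.
rewrite -[RHS]ge0_integral_iid_prod; [|exact: mH|exact: H0].
rewrite [LHS]ge0_integral_prod; first last.
- by move=> w; rewrite lee_fin sumr_ge0// => k _; rewrite sqr_ge0.
- rewrite [X in measurable_fun _ X](_ : _ =
      fun w : n.-tuple (U * unit) * s.-tuple R =>
        G ([tuple of [seq x.1 | x <- w.1]], w.2)); last first.
    by apply/funext => w; rewrite received_det.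
  apply: (measurableT_comp mG); apply: measurable_fun_pair; last by measurable_proj.
  exact: (measurableT_comp (measurable_map_fst n)).
apply: eq_integral => t _; apply: eq_integral => z _.
by rewrite received_det.
Qed.

End risk.

Section sample_joint_law.
Local Open Scope ereal_scope.
Context {R : realType} {dU} {U : measurableType dU} {n s : nat}.
Variables (m : probability U R) (f : {mfun U >-> s.-tuple R}) (a b : R).
Hypotheses (a0 : (0 <= a)%R) (b0 : (0 < b)%R).

(** Brings the sample into the form of the Gaussian channel: user [i] is drawn apart, and the
    signals of the others sum to the known offset. With [n.+1] users, [data_except] has length
    [n]. *)
Lemma sample_joint_law (i : 'I_n.+1) (F : s.-tuple R * (U * n.-tuple U) -> \bar R) :
  measurable_fun setT F -> (forall x, 0 <= F x) ->
  \int[sample_law n.+1 s m (gaussian_vec s a) b]_w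
    F (received (robust_encoder f) w, (data i w, data_except i w)) =
  \int[iid n m]_t \int[m]_u \int[gaussian_vec s (b + n.+1%:R * a)]_z
    F (channel_map f (@sumf _ _ _ _ f n) (t, (u, z)), (u, t)).
Proof.
move=> mF F0.
pose rest (u : n.+1.-tuple U) : n.-tuple U := [tuple tnth u (lift i j) | j < n].
have mrest : measurable_fun setT rest.
  apply/measurable_fun_tnthP => j.
  rewrite (_ : _ \o _ = fun u => tnth u (lift i j)); first exact: measurable_tnth.
  by apply/funext => u /=; rewrite tnth_mktuple.
pose G (x : n.+1.-tuple U * s.-tuple R) :=
  F (addt (sumf f x.1) x.2, (tnth x.1 i, rest x.1)).
have mG : measurable_fun setT G.
  apply: (measurableT_comp mF); apply: measurable_fun_pair.
    by apply: measurable_addt; [apply: (measurableT_comp (measurable_sumf f n.+1))|];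
      measurable_proj.
  apply: measurable_fun_pair.
    by apply: (measurableT_comp (measurable_tnth i)); measurable_proj.
  by apply: (measurableT_comp mrest); measurable_proj.
have G0 x : 0 <= G x by exact: F0.
transitivity (\int[iid n.+1 m]_u \int[gaussian_vec s (b + n.+1%:R * a)]_z G (u, z)).
  rewrite -[RHS]ge0_integral_sample_law; [|exact: a0|exact: b0|exact: mG|exact: G0].
  apply: eq_integral => w _; rewrite received_robust /G/=; congr (F (_, (_, _))).
    by rewrite tnth_map.
  by apply: eq_from_tnth => j; rewrite !tnth_mktuple tnth_map.
rewrite [LHS](ge0_integral_iid_tinsert _ _ i); first last.
- by move=> u; exact: integral_ge0.
- exact: measurable_fun_fubini_tonelli_F.
have GE t u z : G (tinsert i u t, z) =
    F (channel_map f (@sumf _ _ _ _ f n) (t, (u, z)), (u, t)).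
  rewrite /G/= sumf_tinsert -addtA tnth_tinsert; congr (F (_, (_, _))).
  by apply: eq_from_tnth => j; rewrite tnth_mktuple tnth_tinsert_lift.
have mFF : measurable_fun setT (fun x : (U * n.-tuple U) * s.-tuple R =>
    G (tinsert i x.1.1 x.1.2, x.2)).
  apply: (measurableT_comp mG); apply: measurable_fun_pair; last by measurable_proj.
  by apply: (measurableT_comp (measurable_tinsert i)
    (f := fun z : U * n.-tuple U => tinsert i z.1 z.2) (g := fst)); measurable_proj.
rewrite [LHS](fubini_tonelli (fun x : U * n.-tuple U =>
  \int[gaussian_vec s (b + n.+1%:R * a)]_z G (tinsert i x.1 x.2, z))); first last.
- by move=> x; exact: integral_ge0.
- exact: (measurable_fun_fubini_tonelli_F _ mFF).
by do 3 (apply: eq_integral => ? _); rewrite GE.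
Qed.

End sample_joint_law.

(** * Privacy variance and power budget *)

Lemma sigma_pri2_ge0 {R : realType} n s (P v0 eps : R) : 0 <= sigma_pri2 n s P v0 eps.
Proof. by rewrite le_max lexx orbT. Qed.

(** With [a] the privacy variance, the claim is [s (P - a) <= 2 eps (v0 + n a)], that is, [a] is at
    least the fraction inside the maximum defining [sigma_pri2]; equality holds when that fraction
    is nonnegative. *)
Lemma sigma_pri2_budget {R : realType} n s (P v0 eps : R) :
  (1 <= s)%N -> 0 < v0 -> 0 < eps ->
  s%:R * (P - sigma_pri2 n s P v0 eps) /
    (2 * (v0 + n%:R * sigma_pri2 n s P v0 eps)) <= eps.
Proof.
move=> s1 v00 eps0; set a := sigma_pri2 _ _ _ _ _; have a0 : 0 <= a by exact: sigma_pri2_ge0.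
have n0 : 0 <= n%:R :> R by [].
have s0 : 0 < s%:R :> R by rewrite ltr0n.
have den0 : 0 < 2 * eps * n%:R + s%:R :> R by rewrite ltr_wpDl// !mulr_ge0// ltW.
have : (s%:R * P - 2 * eps * v0) / (2 * eps * n%:R + s%:R) <= a by rewrite le_max lexx.
rewrite ler_pdivrMr// => ale; rewrite ler_pdivrMr; first by lra.
by rewrite mulr_gt0// ltr_wpDr// mulr_ge0.
Qed.

Lemma power_constraint_det {R : realType} {dU} {U : measurableType dU} {d s : nat}
    (Theta : set (d.-tuple R)) (p : d.-tuple R -> probability U R)
    (f : {mfun U >-> s.-tuple R}) (P : R) theta :
  (1 <= s)%N -> Theta theta ->
  power_constraint Theta p no_seed (det_encoder f) P ->
  (\sum_(j < s) \int[p theta]_u ((tnth (f u) j) ^+ 2)%:E <= (s%:R * P)%:E)%E.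
Proof.
move=> s1 Ttheta /(_ _ Ttheta).
have s0 : 0 < s%:R :> R by rewrite ltr0n.
have -> : (\sum_(j < s) \int[p theta \x no_seed]_x ((tnth (det_encoder f x) j) ^+ 2)%:E =
    \sum_(j < s) \int[p theta]_u ((tnth (f u) j) ^+ 2)%:E)%E.
  apply: eq_bigr => j _.
  have mfj : measurable_fun setT (fun u => (tnth (f u) j ^+ 2)%:E).
    apply/measurable_EFinP; apply: measurable_funX.
    exact: (measurableT_comp (measurable_tnth j)).
  rewrite [LHS](ge0_integral_prod _ _ (fun x : U * unit => ((tnth (f x.1) j) ^+ 2)%:E)).
  - apply: eq_integral => u _; rewrite /= [LHS]integral_cst; last by [].
    by rewrite [X in (_ * X)%E]probability_setT mule1.
  - by apply: (measurableT_comp mfj); measurable_proj.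
  - by move=> x; rewrite lee_fin sqr_ge0.
by rewrite lee_pdivrMl.
Qed.

(** By [minimax_optimal], the right-hand side of the second claim is the optimal value [R^*]. *)
Theorem theorem2 (R : realType) (dU : measure_display) (U : measurableType dU)
    (d n s : nat) (Theta : set (d.-tuple R))
    (p : d.-tuple R -> probability U R) (P v0 eps : R)
    (est : {mfun s.-tuple R >-> d.-tuple R}) (f : {mfun U >-> s.-tuple R}) :
  (1 <= n)%N -> (1 <= s)%N -> 0 < P -> 0 < v0 -> 0 < eps ->
  let vpri := sigma_pri2 n s P v0 eps in
  minimax_optimal n Theta p (P - vpri) (v0 + n%:R * vpri) est f ->
  (forall theta, Theta theta -> forall i : 'I_n,
     (cond_mutual_info
        (sample_law n s (p theta) (gaussian_vec s vpri) v0)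
        (received (robust_encoder f)) (data i) (data_except i)
      <= eps%:E)%E)
  /\ worst_risk n Theta p (gaussian_vec s vpri) (robust_encoder f) v0 est
     = det_worst_risk n Theta p (v0 + n%:R * vpri) f est.
Proof.
move=> n1 s1 _ v00 eps0 vpri [[_ power] _].
have vpri0 : 0 <= vpri by exact: sigma_pri2_ge0.
split; last first.
  rewrite /det_worst_risk /worst_risk; congr ereal_sup.
  by apply: eq_imagel => theta _; rewrite risk_robust// risk_det.
move=> theta Ttheta i.
have budget := sigma_pri2_budget n s P v0 eps s1 v00 eps0.
rewrite -/vpri in budget.
apply: le_trans (_ : ((s%:R * (P - vpri) / (2 * (v0 + n%:R * vpri)))%:E <= _)%E); last first.
  by rewrite lee_fin.
(* Exposing [n] as a successor gives the tuple of the other users, of length [n.-1], its length in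
   [sample_joint_law]. *)
case: n n1 @vpri power vpri0 i budget => [//|n] _ vpri power vpri0 i budget.
apply: (cond_mutual_info_gaussian_le _ _ _ _ (p theta) (iid n (p theta)) _ f
  (@sumf _ _ _ _ f n)).
- by rewrite ltr_wpDr// mulr_ge0.
- by move=> F mF F0; exact: sample_joint_law.
- exact: power_constraint_det s1 Ttheta power.
Qed.
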